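(* For every fixed environment $\omega=(\omega_x)_{x\in\mathbb Z}\in\mathbb R^{\mathbb Z}$ and all real $-\infty<u\le v<\infty$, $$\lim_{n\to\infty} P^{\omega}_n\!\left(u\le \frac{X_n}{n}\le v\right)=\int_u^v \{1-\sin(\omega_0)\,x\}\, f_K(x)\,dx,$$ where $$f_K(x)=\frac{1}{\pi(1-x^2)\sqrt{1-2x^2}}\,I_{(-1/\sqrt2,\,1/\sqrt2)}(x),$$ and $I_A$ denotes the indicator function of $A$.
   Context: Quantum walk in an environment $\omega=(\omega_x)_{x\in\mathbb Z}$, $\omega_x\in\mathbb R$. For $x\in\mathbb Z$ let $$U_x=\frac{1}{\sqrt2}\begin{pmatrix} e^{i\omega_x} & 1\\ 1 & -e^{-i\omega_x}\end{pmatrix}=\begin{pmatrix} a_x & b_x\\ c_x & d_x\end{pmatrix},\qquad P_x=\begin{pmatrix} a_x & b_x\\ 0&0\end{pmatrix},\quad Q_x=\begin{pmatrix} 0&0\\ c_x & d_x\end{pmatrix}.$$ For integers $l,m$ define $2\times2$ matrices $\Xi_n(l,m)$, $n=l+m$, by $\Xi_0(0,0)=I$, $\Xi_n(l,m)=0$ if $l<0$ or $m<0$, and for $l,m\ge0$ with $l+m=n+1\ge1$, writing $x=-l+m$, $$\Xi_{n+1}(l,m)=P_{x+1}\,\Xi_n(l-1,m)+Q_{x-1}\,\Xi_n(l,m-1).$$ (Equivalently, $\Xi_n(l,m)$ is the sum over all nearest-neighbour paths from $0$ with $l$ left steps and $m$ right steps of the ordered product, latest step leftmost, of $P_y$ for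 each left step from site $y$ and $Q_y$ for each right step from site $y$.) Let $\varphi_*={}^T[1/\sqrt2,\,i/\sqrt2]$. The quenched law of the position $X_n$ at time $n$ is $P^{\omega}_n(X_n=x)=\|\Xi_n(l,m)\varphi_*\|^2$ for $x=-l+m$, $n=l+m$, $l,m\ge0$ (and $0$ for other $x$); this is a probability distribution on $\mathbb Z$. *)

(* Defs.v *)
From Stdlib Require Import Reals Lra Lia ZArith.
Open Scope R_scope.

Record Cx := mkCx { re : R; im : R }.
Definition C0 : Cx := mkCx 0 0.
Definition C1 : Cx := mkCx 1 0.
Definition Cadd (z w : Cx) : Cx := mkCx (re z + re w) (im z + im w).
Definition Cmul (z w : Cx) : Cx :=
  mkCx (re z * re w - im z * im w) (re z * im w + im z * re w).
Definition Cnormsq (z : Cx) : R := re z * re z + im z * im z.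

Record M2 := mkM2 { e11 : Cx; e12 : Cx; e21 : Cx; e22 : Cx }.
Record V2 := mkV2 { v1 : Cx; v2 : Cx }.
Definition M0 : M2 := mkM2 C0 C0 C0 C0.
Definition MI : M2 := mkM2 C1 C0 C0 C1.
Definition Madd (A B : M2) : M2 :=
  mkM2 (Cadd (e11 A) (e11 B)) (Cadd (e12 A) (e12 B))
       (Cadd (e21 A) (e21 B)) (Cadd (e22 A) (e22 B)).
Definition Mmul (A B : M2) : M2 :=
  mkM2 (Cadd (Cmul (e11 A) (e11 B)) (Cmul (e12 A) (e21 B)))
       (Cadd (Cmul (e11 A) (e12 B)) (Cmul (e12 A) (e22 B)))
       (Cadd (Cmul (e21 A) (e11 B)) (Cmul (e22 A) (e21 B)))
       (Cadd (Cmul (e21 A) (e12 B)) (Cmul (e22 A) (e22 B))).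
Definition Mapp (A : M2) (v : V2) : V2 :=
  mkV2 (Cadd (Cmul (e11 A) (v1 v)) (Cmul (e12 A) (v2 v)))
       (Cadd (Cmul (e21 A) (v1 v)) (Cmul (e22 A) (v2 v))).
Definition Vnormsq (v : V2) : R := Cnormsq (v1 v) + Cnormsq (v2 v).

(* U_x = 1/sqrt2 [[e^{i w_x}, 1], [1, - e^{-i w_x}]] *)
Definition a_ (omega : Z -> R) (x : Z) : Cx :=
  mkCx (cos (omega x) / sqrt 2) (sin (omega x) / sqrt 2).
Definition b_ (omega : Z -> R) (x : Z) : Cx := mkCx (1 / sqrt 2) 0.
Definition c_ (omega : Z -> R) (x : Z) : Cx := mkCx (1 / sqrt 2) 0.
Definition d_ (omega : Z -> R) (x : Z) : Cx :=
  mkCx (- cos (omega x) / sqrt 2) (sin (omega x) / sqrt 2).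
Definition Pm (omega : Z -> R) (x : Z) : M2 := mkM2 (a_ omega x) (b_ omega x) C0 C0.
Definition Qm (omega : Z -> R) (x : Z) : M2 := mkM2 C0 C0 (c_ omega x) (d_ omega x).

(* Xi omega l m = Xi_{l+m}(l,m); with x = -l+m,
   Xi(l,m) = P_{x+1} Xi(l-1,m) + Q_{x-1} Xi(l,m-1), terms with a negative index being 0. *)
Fixpoint Xi (omega : Z -> R) (l : nat) : nat -> M2 :=
  fix Xi' (m : nat) : M2 :=
    let x := (Z.of_nat m - Z.of_nat l)%Z in
    match l, m with
    | O, O => MI
    | S l', O => Mmul (Pm omega (x + 1)%Z) (Xi omega l' O)
    | O, S m' => Mmul (Qm omega (x - 1)%Z) (Xi' m')
    | S l', S m' => Madd (Mmul (Pm omega (x + 1)%Z) (Xi omega l' (S m')))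
                         (Mmul (Qm omega (x - 1)%Z) (Xi' m'))
    end.

Definition phi_star : V2 := mkV2 (mkCx (1 / sqrt 2) 0) (mkCx 0 (1 / sqrt 2)).

(* P^omega_n(X_n = -l+m) for l + m = n *)
Definition prob_lm (omega : Z -> R) (l m : nat) : R := Vnormsq (Mapp (Xi omega l m) phi_star).

Definition prob_interval (omega : Z -> R) (n : nat) (u v : R) : R :=
  sum_f_R0 (fun l =>
    let m := (n - l)%nat in
    let y := (INR m - INR l) / INR n in
    if Rle_dec u y then (if Rle_dec y v then prob_lm omega l m else 0) else 0) n.

Definition fK (x : R) : R :=
  if Rlt_dec (- (1 / sqrt 2)) x then
    if Rlt_dec x (1 / sqrt 2) then
      1 / (PI * (1 - x ^ 2) * sqrt (1 - 2 * x ^ 2))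
    else 0
  else 0.

Definition improper_integral (g : R -> R) (a b I : R) : Prop :=
  (forall c d, a < c -> c <= d -> d < b -> inhabited (Riemann_integrable g c d)) /\
  (forall eps, 0 < eps -> exists delta, 0 < delta /\
     forall c d (pr : Riemann_integrable g c d),
       a < c -> c < a + delta -> b - delta < d -> d < b -> c <= d ->
       Rabs (RiemannInt pr - I) < eps).

(* integral over [u,v] of a function g supported in (-1/sqrt2, 1/sqrt2):
   integral over (max(u,-1/sqrt2), min(v,1/sqrt2)) in the improper sense, 0 if empty *)
Definition integral_on_support (g : R -> R) (u v I : R) : Prop :=
  let a := Rmax u (- (1 / sqrt 2)) in
  let b := Rmin v (1 / sqrt 2) in
  (b <= a /\ I = 0) \/ (a < b /\ improper_integral g a b I).

(* Main.v *)
Require Import Defs.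
From Stdlib Require Import Reals ZArith Lra Lia.
From Coquelicot Require Import Coquelicot.
Open Scope R_scope.

(** A position-dependent phase turns the walk into the homogeneous one with coin
    [[1, 1], [-1, 1]] / sqrt 2, the environment surviving only through [omega 0] in the initial
    state; as this coin is real, the real and imaginary parts of the state evolve independently.
    In Fourier space one step is a matrix of SU(2) with eigenvalues [exp (± i phase k)], where
    [cos (phase k) = cos k / sqrt 2].  By Parseval, the mean of [exp (i xi X_n / n)] is an integral
    of the overlap of the states at [k] and [k + xi / n]; since [phase' = vel], this overlap
    converges uniformly at rate 1/n, and the limit is the integral of
    [exp (i xi vel k) (1 - sin (omega 0) vel k) / PI] over [-PI/2, PI/2].  Polynomials in [sin x]
    that approximate indicators of half-lines on [-1, 1] then give the convergence of the
    distribution functions, and the substitution [x = vel k] produces the density [fK]. *)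

(** * The group velocity *)

(** All sites reached at time n have the parity of n, so the Fourier transforms are [PI]-periodic up
    to sign and a half period suffices for Parseval; on it [vel] is strictly increasing, so a
    half-line of velocities pulls back to an interval of wave numbers. The phases [INR n * phase k]
    oscillate faster and faster, yet no stationary-phase argument is required: the overlap of the
    states at k and at [k + xi / INR n] depends to leading order on the difference of the two phases
    only, and every other oscillating term carries an increment of [vel] or [covel], of order 1/n.
    The passage from trigonometric means to distribution functions rests on one closure property:
    multiplication by [sin] moves a frequency xi to [xi + 1] and [xi - 1], so polynomials in [sin]
    remain exactly within reach of the trigonometric limits. They can separate points because X_n /
    n lies in [-1, 1], where [sin] is injective. *)

Definition vel (k : R) : R := sin k / sqrt (1 + sin k ^ 2).
Definition covel (k : R) : R := cos k / sqrt (1 + sin k ^ 2).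
(** The angle in (0, [PI]) with cotangent [covel k]; through [atan] it is differentiable for every k
    without side conditions. *)
Definition phase (k : R) : R := PI / 2 - atan (covel k).

Lemma one_plus_sqr_gt0 (x : R) : 0 < 1 + x ^ 2.
Proof. generalize (pow2_ge_0 x); lra. Qed.

Lemma sqrt_one_plus_sqr (x : R) : 0 < sqrt (1 + x ^ 2) /\ sqrt (1 + x ^ 2) ^ 2 = 1 + x ^ 2.
Proof.
  generalize (one_plus_sqr_gt0 x); intros H; split.
  - now apply sqrt_lt_R0.
  - now apply pow2_sqrt, Rlt_le.
Qed.

Lemma sqrt2_gt0 : 0 < sqrt 2.
Proof. apply sqrt_lt_R0; lra. Qed.

Lemma sqrt2_sqr : sqrt 2 * sqrt 2 = 2.
Proof. apply sqrt_sqrt; lra. Qed.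

Lemma cos_sqr (k : R) : cos k ^ 2 = 1 - sin k ^ 2.
Proof. generalize (sin2_cos2 k); unfold Rsqr; nra. Qed.

Lemma covel_vel_sqr (k : R) : covel k ^ 2 + 2 * vel k ^ 2 = 1.
Proof.
  unfold covel, vel; destruct (sqrt_one_plus_sqr (sin k)) as [H1 H2].
  generalize (cos_sqr k) (one_plus_sqr_gt0 (sin k)); intros H3 H4.
  unfold Rdiv; rewrite !Rpow_mult_distr, pow_inv, H2, H3; field; lra.
Qed.

Lemma sqrt_one_plus_covel (k : R) :
  sqrt (1 + (covel k)²) = sqrt 2 / sqrt (1 + sin k ^ 2).
Proof.
  rewrite <- sqrt_div by (generalize (one_plus_sqr_gt0 (sin k)); lra).
  f_equal; unfold covel, Rsqr.
  destruct (sqrt_one_plus_sqr (sin k)) as [H1 H2].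
  generalize (cos_sqr k) (one_plus_sqr_gt0 (sin k)); intros H3 H4.
  replace (cos k / sqrt (1 + sin k ^ 2) * (cos k / sqrt (1 + sin k ^ 2)))
    with (cos k ^ 2 / sqrt (1 + sin k ^ 2) ^ 2) by (field; lra).
  rewrite H2, H3; field; lra.
Qed.

Lemma cos_phase (k : R) : cos (phase k) = cos k / sqrt 2.
Proof.
  unfold phase; rewrite cos_shift, sin_atan, sqrt_one_plus_covel; unfold covel.
  destruct (sqrt_one_plus_sqr (sin k)) as [H1 _]; generalize sqrt2_gt0; intros H.
  field; split; lra.
Qed.

Lemma sin_phase (k : R) : sin (phase k) = sqrt (1 + sin k ^ 2) / sqrt 2.
Proof.
  unfold phase; rewrite sin_shift, cos_atan, sqrt_one_plus_covel.
  destruct (sqrt_one_plus_sqr (sin k)) as [H1 _]; generalize sqrt2_gt0; intros H.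
  field; split; lra.
Qed.

Lemma is_derive_vel (k : R) : is_derive vel k (cos k / sqrt (1 + sin k ^ 2) ^ 3).
Proof.
  destruct (sqrt_one_plus_sqr (sin k)) as [H1 H2]; generalize (one_plus_sqr_gt0 (sin k)); intros H.
  unfold vel; auto_derive; [split; [exact H | split; [exact (Rgt_not_eq _ _ H1) | exact I]] |].
  change (1 + sin k * (sin k * 1)) with (1 + sin k ^ 2). set (D := sqrt _) in *.
  apply (Rmult_eq_reg_r (D ^ 3)); [| apply pow_nonzero; lra].
  field_simplify; [| lra | lra]. rewrite H2; ring.
Qed.

Lemma is_derive_covel (k : R) :
  is_derive covel k (- 2 * sin k / sqrt (1 + sin k ^ 2) ^ 3).
Proof.
  destruct (sqrt_one_plus_sqr (sin k)) as [H1 H2]; generalize (one_plus_sqr_gt0 (sin k)); intros H.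
  unfold covel; auto_derive; [split; [exact H | split; [exact (Rgt_not_eq _ _ H1) | exact I]] |].
  change (1 + sin k * (sin k * 1)) with (1 + sin k ^ 2). set (D := sqrt _) in *.
  apply (Rmult_eq_reg_r (D ^ 3)); [| apply pow_nonzero; lra].
  field_simplify; [| lra | lra]. rewrite H2, cos_sqr; ring.
Qed.

Lemma is_derive_phase (k : R) : is_derive phase k (vel k).
Proof.
  unfold phase.
  evar_last.
  { apply @is_derive_minus; [apply is_derive_const |].
    apply (is_derive_comp atan covel); [apply is_derive_atan | apply is_derive_covel]. }
  simpl; unfold minus, plus, opp, zero, scal, mult; simpl; unfold mult; simpl.
  destruct (sqrt_one_plus_sqr (sin k)) as [H1 H2]; generalize (one_plus_sqr_gt0 (sin k)); intros H.
  generalize (cos_sqr k); intros H3.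
  assert (E : 1 + (covel k) ^ 2 = 2 / (1 + sin k ^ 2)).
  { unfold covel, Rdiv; rewrite Rpow_mult_distr, pow_inv, H2, H3; field; lra. }
  unfold Rsqr; replace (covel k * covel k) with (covel k ^ 2) by ring.
  rewrite E; unfold vel. 
  set (D := sqrt _) in *. rewrite <- H2. field; lra.
Qed.

Lemma sqrt_one_plus_sqr_cube_ge1 (x : R) : 1 <= sqrt (1 + x ^ 2) ^ 3.
Proof.
  apply pow_R1_Rle; rewrite <- sqrt_1 at 1; apply sqrt_le_1_alt.
  generalize (pow2_ge_0 x); lra.
Qed.

Lemma Rabs_div_le (x y : R) : 1 <= y -> Rabs (x / y) <= Rabs x.
Proof.
  intros H; unfold Rdiv; rewrite Rabs_mult, (Rabs_pos_eq (/ y))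
    by (apply Rlt_le, Rinv_0_lt_compat; lra).
  generalize (Rabs_pos x) (Rinv_le_contravar 1 y Rlt_0_1 H); rewrite Rinv_1; nra.
Qed.

Lemma Rabs_sin_le1 (x : R) : Rabs (sin x) <= 1.
Proof. apply Rabs_le, SIN_bound. Qed.

Lemma Rabs_cos_le1 (x : R) : Rabs (cos x) <= 1.
Proof. apply Rabs_le, COS_bound. Qed.

Lemma vel_lip (x y : R) : Rabs (vel y - vel x) <= 1 * Rabs (y - x).
Proof.
  apply (bounded_variation vel (fun t => cos t / sqrt (1 + sin t ^ 2) ^ 3)); intros t _; split.
  - apply is_derive_vel.
  - eapply Rle_trans; [apply Rabs_div_le, sqrt_one_plus_sqr_cube_ge1 | apply Rabs_cos_le1].
Qed.

Lemma covel_lip (x y : R) : Rabs (covel y - covel x) <= 2 * Rabs (y - x).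
Proof.
  apply (bounded_variation covel (fun t => - 2 * sin t / sqrt (1 + sin t ^ 2) ^ 3)); intros t _; split.
  - apply is_derive_covel.
  - eapply Rle_trans; [apply Rabs_div_le, sqrt_one_plus_sqr_cube_ge1 |].
    rewrite Rabs_mult, Rabs_left by lra. generalize (Rabs_sin_le1 t); lra.
Qed.

Lemma sin_lip (x y : R) : Rabs (sin y - sin x) <= 1 * Rabs (y - x).
Proof.
  apply (bounded_variation sin cos); intros t _; split;
    [apply is_derive_sin | apply Rabs_cos_le1].
Qed.

Lemma cos_lip (x y : R) : Rabs (cos y - cos x) <= 1 * Rabs (y - x).
Proof.
  apply (bounded_variation cos (fun t => - sin t)); intros t _; split;
    [apply is_derive_cos | rewrite Rabs_Ropp; apply Rabs_sin_le1].
Qed.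

(** Mean value theorem, with the 1-Lipschitz bound on [phase' = vel]. For [d = xi / INR n],
    multiplication by n leaves an error [xi ^ 2 / INR n]. *)
Lemma phase_increment (x d : R) : Rabs (phase (x + d) - phase x - d * vel x) <= d ^ 2.
Proof.
  destruct (MVT_gen phase x (x + d) vel) as [c [Hc E]].
  - intros; apply is_derive_phase.
  - intros t _; apply derivable_continuous_pt; exists (vel t).
    apply is_derive_Reals, is_derive_phase.
  - rewrite E; replace (vel c * (x + d - x) - d * vel x) with (d * (vel c - vel x)) by ring.
    rewrite Rabs_mult, <- (pow2_abs d).
    replace (Rabs d ^ 2) with (Rabs d * Rabs d) by ring.
    apply Rmult_le_compat_l; [apply Rabs_pos |].
    eapply Rle_trans; [apply vel_lip | rewrite Rmult_1_l].
    unfold Rmin, Rmax in Hc; destruct (Rle_dec x (x + d)) in Hc.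
    + rewrite !Rabs_pos_eq; lra.
    + rewrite !Rabs_left1; lra.
Qed.

(** * Fourier analysis of the real walk *)

Lemma sum_lin2 (x y : R) (f g : nat -> R) (n : nat) :
  sum_f_R0 (fun i => x * f i + y * g i) n = x * sum_f_R0 f n + y * sum_f_R0 g n.
Proof. induction n as [|n IH]; simpl; [ring | rewrite IH; ring]. Qed.

Lemma sum_scal (x : R) (f : nat -> R) (n : nat) :
  sum_f_R0 (fun i => x * f i) n = x * sum_f_R0 f n.
Proof. induction n as [|n IH]; simpl; [ring | rewrite IH; ring]. Qed.

Lemma sum_shift (f : nat -> R) (n : nat) :
  sum_f_R0 f (S n) = f 0%nat + sum_f_R0 (fun i => f (S i)) n.
Proof. rewrite decomp_sum by lia; reflexivity. Qed.

Lemma sum_kronecker (g : nat -> R) (l n : nat) :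
  (l <= n)%nat -> sum_f_R0 (fun m => if Nat.eq_dec l m then g m else 0) n = g l.
Proof.
  intros H; induction n as [|n IH].
  - replace l with 0%nat by lia; reflexivity.
  - simpl; destruct (Nat.eq_dec l (S n)) as [->|E].
    + rewrite sum_eq_R0; [ring |].
      intros m Hm; destruct (Nat.eq_dec (S n) m); [lia | reflexivity].
    + rewrite IH by lia; ring.
Qed.

Lemma is_RInt_sum (f : nat -> R -> R) (v : nat -> R) (a b : R) (n : nat) :
  (forall i, (i <= n)%nat -> is_RInt (f i) a b (v i)) ->
  is_RInt (fun x => sum_f_R0 (fun i => f i x) n) a b (sum_f_R0 v n).
Proof.
  induction n as [|n IH]; intros H; simpl.
  - now apply H.
  - apply (is_RInt_plus (V := R_NormedModule)); [apply IH; intros; apply H | apply H]; lia.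
Qed.

(** Position after n steps, l of them to the left. Two sites at the same time differ by an even
    integer. *)
Definition site (n l : nat) : R := INR n - 2 * INR l.

Definition cos_sum (A : nat -> R) (n : nat) (k : R) : R :=
  sum_f_R0 (fun l => A l * cos (k * site n l)) n.
Definition sin_sum (A : nat -> R) (n : nat) (k : R) : R :=
  sum_f_R0 (fun l => A l * sin (k * site n l)) n.

(** Real part of [exp (- i tau)] times the conjugate transform of A at k times its transform at
    [k + d]. *)
Definition corr (A : nat -> R) (n : nat) (d tau k : R) : R :=
  cos tau * (cos_sum A n k * cos_sum A n (k + d) + sin_sum A n k * sin_sum A n (k + d))
  + sin tau * (cos_sum A n k * sin_sum A n (k + d) - sin_sum A n k * cos_sum A n (k + d)).

Lemma corr_double_sum (A : nat -> R) (n : nat) (d tau k : R) :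
  corr A n d tau k =
  sum_f_R0 (fun l => A l * sum_f_R0 (fun m => A m *
    cos (k * (site n m - site n l) + (d * site n m - tau))) n) n.
Proof.
  transitivity (sum_f_R0 (fun l =>
    cos_sum A n (k + d) * (cos tau * (A l * cos (k * site n l)) + (- sin tau) * (A l * sin (k * site n l)))
    + sin_sum A n (k + d) * (cos tau * (A l * sin (k * site n l)) + sin tau * (A l * cos (k * site n l)))) n).
  - rewrite sum_lin2, !sum_lin2; unfold corr, cos_sum, sin_sum; ring.
  - apply sum_eq; intros l _.
    transitivity (A l * (cos (k * site n l + tau) * cos_sum A n (k + d)
                         + sin (k * site n l + tau) * sin_sum A n (k + d))).
    + rewrite cos_plus, sin_plus; ring.
    + unfold cos_sum, sin_sum; rewrite <- sum_lin2; f_equal.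
      apply sum_eq; intros m _.
      replace (k * (site n m - site n l) + (d * site n m - tau))
        with ((k + d) * site n m - (k * site n l + tau)) by ring.
      rewrite cos_minus; ring.
Qed.

(** For [j <> 0] the interval, of length [PI], holds a whole number of periods. *)
Lemma is_RInt_cos_even_freq (j : Z) (e : R) :
  is_RInt (fun k => cos (k * (2 * IZR j) + e)) (- (PI / 2)) (PI / 2)
    (if Z.eq_dec j 0 then PI * cos e else 0).
Proof.
  destruct (Z.eq_dec j 0) as [->|Hj].
  - apply (is_RInt_ext (fun _ => cos e)); [intros; f_equal; ring |].
    replace (PI * cos e) with (scal (PI / 2 - - (PI / 2)) (cos e)).
    + apply (is_RInt_const (V := R_NormedModule)).
    + unfold scal; simpl; unfold mult; simpl; field.
  - assert (Hj' : IZR j <> 0) by (apply not_0_IZR; exact Hj).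
    evar_last.
    { apply (is_RInt_derive (fun k => sin (k * (2 * IZR j) + e) / (2 * IZR j))).
      - intros x _; auto_derive; [exact I | field; lra].
      - intros x _; apply (ex_derive_continuous (V := R_NormedModule)); auto_derive; exact I. }
    unfold minus, plus, opp; simpl.
    replace (PI / 2 * (2 * IZR j) + e) with (e + IZR j * PI) by field.
    replace (- (PI / 2) * (2 * IZR j) + e) with (e - IZR j * PI) by field.
    rewrite sin_plus, sin_minus.
    rewrite (sin_eq_0_1 (IZR j * PI)) by (now exists j).
    field; lra.
Qed.

(** Parseval: the frequencies of the double sum are [2 (l - m)], so only its diagonal survives
    integration. *)
Lemma is_RInt_corr (A : nat -> R) (n : nat) (d tau : R) :
  is_RInt (corr A n d tau) (- (PI / 2)) (PI / 2)
    (PI * sum_f_R0 (fun l => A l ^ 2 * cos (d * site n l - tau)) n).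
Proof.
  apply (is_RInt_ext (fun k => sum_f_R0 (fun l => A l * sum_f_R0 (fun m => A m *
    cos (k * (site n m - site n l) + (d * site n m - tau))) n) n)).
  { intros k _; symmetry; apply corr_double_sum. }
  rewrite <- sum_scal; apply is_RInt_sum; intros l Hl.
  replace (PI * _) with (A l * sum_f_R0 (fun m => A m *
    (if Nat.eq_dec l m then PI * cos (d * site n m - tau) else 0)) n).
  2: { rewrite (sum_eq _ (fun m => if Nat.eq_dec l m then A m * (PI * cos (d * site n m - tau)) else 0)).
       - rewrite sum_kronecker by exact Hl; ring.
       - intros m _; destruct (Nat.eq_dec l m); ring. }
  apply (is_RInt_scal (V := R_NormedModule)), is_RInt_sum; intros m _.
  apply (is_RInt_scal (V := R_NormedModule)).
  apply (is_RInt_ext (fun k => cos (k * (2 * IZR (Z.of_nat l - Z.of_nat m)) + (d * site n m - tau)))).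
  { intros k _; unfold site; rewrite minus_IZR, <- !INR_IZR_INZ; do 2 f_equal; ring. }
  generalize (is_RInt_cos_even_freq (Z.of_nat l - Z.of_nat m) (d * site n m - tau)).
  destruct (Z.eq_dec _ _), (Nat.eq_dec _ _); (lia || easy).
Qed.

(** The homogeneous real walk started from (a, b), indexed by left steps instead of sites: a left
    step raises l and a right step keeps it. *)
Fixpoint amp (a b : R) (n l : nat) : R * R :=
  match n with
  | O => match l with O => (a, b) | S _ => (0, 0) end
  | S n' =>
    (match l with
     | O => 0
     | S l' => (fst (amp a b n' l') + snd (amp a b n' l')) / sqrt 2
     end,
     (snd (amp a b n' l) - fst (amp a b n' l)) / sqrt 2)
  end.

Definition ampL (a b : R) (n l : nat) : R := fst (amp a b n l).
Definition ampR (a b : R) (n l : nat) : R := snd (amp a b n l).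

Lemma ampL_0 (a b : R) (n : nat) : ampL a b (S n) 0 = 0.
Proof. reflexivity. Qed.

Lemma ampL_S (a b : R) (n l : nat) :
  ampL a b (S n) (S l) = (ampL a b n l + ampR a b n l) / sqrt 2.
Proof. reflexivity. Qed.

Lemma ampR_S (a b : R) (n l : nat) :
  ampR a b (S n) l = (ampR a b n l - ampL a b n l) / sqrt 2.
Proof. reflexivity. Qed.

Lemma amp_outside (a b : R) (n l : nat) :
  (n < l)%nat -> ampL a b n l = 0 /\ ampR a b n l = 0.
Proof.
  revert l; induction n as [|n IH]; intros l H; (destruct l as [|l]; [lia |]).
  - now split.
  - rewrite ampL_S, ampR_S.
    destruct (IH l) as [-> ->]; [lia |]; destruct (IH (S l)) as [-> ->]; [lia |].
    split; unfold Rdiv; ring.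
Qed.

Lemma site_S (n l : nat) : site (S n) l = site n l + 1.
Proof. unfold site; rewrite S_INR; ring. Qed.

Lemma site_SS (n l : nat) : site (S n) (S l) = site n l - 1.
Proof. unfold site; rewrite !S_INR; ring. Qed.

Lemma sum_ampL (a b : R) (n : nat) (g : nat -> R) :
  sum_f_R0 (fun l => ampL a b (S n) l * g l) (S n) =
  sum_f_R0 (fun l => (ampL a b n l + ampR a b n l) / sqrt 2 * g (S l)) n.
Proof.
  rewrite sum_shift, ampL_0, Rmult_0_l, Rplus_0_l.
  apply sum_eq; intros l _; now rewrite ampL_S.
Qed.

Lemma sum_ampR (a b : R) (n : nat) (g : nat -> R) :
  sum_f_R0 (fun l => ampR a b (S n) l * g l) (S n) =
  sum_f_R0 (fun l => (ampR a b n l - ampL a b n l) / sqrt 2 * g l) n.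
Proof.
  (* The last term, [l = S n], would require more than n left steps in n steps. *)
  rewrite tech5, ampR_S; destruct (amp_outside a b n (S n)) as [-> ->]; [lia |].
  replace ((0 - 0) / sqrt 2 * g (S n)) with 0 by (unfold Rdiv; ring).
  rewrite Rplus_0_r; apply sum_eq; intros l _; now rewrite ampR_S.
Qed.

Lemma sum_lin4 (x y z t : R) (f g p q : nat -> R) (n : nat) :
  sum_f_R0 (fun i => x * f i + y * g i + (z * p i + t * q i)) n =
  x * sum_f_R0 f n + y * sum_f_R0 g n + (z * sum_f_R0 p n + t * sum_f_R0 q n).
Proof. rewrite sum_plus, !sum_lin2; reflexivity. Qed.

(** In complex form, with transforms L and R of the two components, L becomes
    [exp (- i k) (L + R) / sqrt 2] and R becomes [exp (i k) (R - L) / sqrt 2]. *)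
Lemma fourier_step (a b : R) (n : nat) (k : R) :
  let Ca := cos_sum (ampL a b n) n k in let Sa := sin_sum (ampL a b n) n k in
  let Cb := cos_sum (ampR a b n) n k in let Sb := sin_sum (ampR a b n) n k in
  cos_sum (ampL a b (S n)) (S n) k = (cos k * (Ca + Cb) + sin k * (Sa + Sb)) / sqrt 2 /\
  sin_sum (ampL a b (S n)) (S n) k = (cos k * (Sa + Sb) - sin k * (Ca + Cb)) / sqrt 2 /\
  cos_sum (ampR a b (S n)) (S n) k = (cos k * (Cb - Ca) - sin k * (Sb - Sa)) / sqrt 2 /\
  sin_sum (ampR a b (S n)) (S n) k = (cos k * (Sb - Sa) + sin k * (Cb - Ca)) / sqrt 2.
Proof.
  intros Ca Sa Cb Sb; unfold Ca, Sa, Cb, Sb, cos_sum, sin_sum; repeat split.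
  all: rewrite ?sum_ampL, ?sum_ampR.
  - transitivity (sum_f_R0 (fun l =>
      cos k / sqrt 2 * (ampL a b n l * cos (k * site n l)) + cos k / sqrt 2 * (ampR a b n l * cos (k * site n l))
      + (sin k / sqrt 2 * (ampL a b n l * sin (k * site n l)) + sin k / sqrt 2 * (ampR a b n l * sin (k * site n l)))) n).
    + apply sum_eq; intros l _; rewrite site_SS.
      replace (k * (site n l - 1)) with (k * site n l - k) by ring; rewrite cos_minus; unfold Rdiv; ring.
    + rewrite sum_lin4; unfold Rdiv; ring.
  - transitivity (sum_f_R0 (fun l =>
      cos k / sqrt 2 * (ampL a b n l * sin (k * site n l)) + cos k / sqrt 2 * (ampR a b n l * sin (k * site n l))
      + (- sin k / sqrt 2 * (ampL a b n l * cos (k * site n l)) + - sin k / sqrt 2 * (ampR a b n l * cos (k * site n l)))) n).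
    + apply sum_eq; intros l _; rewrite site_SS.
      replace (k * (site n l - 1)) with (k * site n l - k) by ring; rewrite sin_minus; unfold Rdiv; ring.
    + rewrite sum_lin4; unfold Rdiv; ring.
  - transitivity (sum_f_R0 (fun l =>
      - cos k / sqrt 2 * (ampL a b n l * cos (k * site n l)) + cos k / sqrt 2 * (ampR a b n l * cos (k * site n l))
      + (sin k / sqrt 2 * (ampL a b n l * sin (k * site n l)) + - sin k / sqrt 2 * (ampR a b n l * sin (k * site n l)))) n).
    + apply sum_eq; intros l _; rewrite site_S.
      replace (k * (site n l + 1)) with (k * site n l + k) by ring; rewrite cos_plus; unfold Rdiv; ring.
    + rewrite sum_lin4; unfold Rdiv; ring.
  - transitivity (sum_f_R0 (fun l =>
      - cos k / sqrt 2 * (ampL a b n l * sin (k * site n l)) + cos k / sqrt 2 * (ampR a b n l * sin (k * site n l))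
      + (- sin k / sqrt 2 * (ampL a b n l * cos (k * site n l)) + sin k / sqrt 2 * (ampR a b n l * cos (k * site n l)))) n).
    + apply sum_eq; intros l _; rewrite site_S.
      replace (k * (site n l + 1)) with (k * site n l + k) by ring; rewrite sin_plus; unfold Rdiv; ring.
    + rewrite sum_lin4; unfold Rdiv; ring.
Qed.

(** The step matrix is cos (phase k) I + sin (phase k) J, where J has rows (- i vel, covel - i vel)
    and (- covel - i vel, i vel). Since [covel_vel_sqr] gives J^2 = - I, its n-th power replaces the
    angle by n times the angle, so no eigenvectors are needed. *)
Lemma fourier_formula (a b : R) (n : nat) (k : R) :
  let C := cos (INR n * phase k) in let S := sin (INR n * phase k) in
  cos_sum (ampL a b n) n k = C * a + S * (covel k * b) /\
  sin_sum (ampL a b n) n k = - S * (vel k * (a + b)) /\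
  cos_sum (ampR a b n) n k = C * b - S * (covel k * a) /\
  sin_sum (ampR a b n) n k = S * (vel k * (b - a)).
Proof.
  induction n as [|n IH].
  - unfold cos_sum, sin_sum, site, ampL, ampR; simpl.
    replace (k * (0 - 2 * 0)) with 0 by ring; rewrite !Rmult_0_l, cos_0, sin_0.
    repeat split; ring.
  - destruct (fourier_step a b n k) as (E1 & E2 & E3 & E4).
    destruct IH as (F1 & F2 & F3 & F4).
    cbv zeta; rewrite E1, E2, E3, E4, F1, F2, F3, F4.
    rewrite S_INR; replace ((INR n + 1) * phase k) with (INR n * phase k + phase k) by ring.
    rewrite cos_plus, sin_plus, cos_phase, sin_phase.
    generalize (cos (INR n * phase k)) (sin (INR n * phase k)); intros C S.
    unfold covel, vel.
    destruct (sqrt_one_plus_sqr (sin k)) as [H1 H2]; generalize sqrt2_gt0 (cos_sqr k); intros H3 H4.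
    set (D := sqrt (1 + sin k ^ 2)) in *; set (r := sqrt 2) in *.
    (* The one relation modulo which the four identities hold as rational identities in the sine,
       the cosine, [D] and [r]. *)
    assert (H5 : D ^ 2 = cos k ^ 2 + 2 * sin k ^ 2) by lra.
    clearbody D r; clear - H1 H3 H5; revert H5; generalize (sin k) (cos k); intros s c H5.
    repeat split; field_simplify_eq; try (split; lra); rewrite ?H5; ring.
Qed.

(** * Limits of trigonometric means *)

Lemma Rabs_mult_le (x y X Y : R) : Rabs x <= X -> Rabs y <= Y -> Rabs (x * y) <= X * Y.
Proof.
  intros Hx Hy; rewrite Rabs_mult.
  apply Rmult_le_compat; auto using Rabs_pos.
Qed.

Lemma Rabs_vel_le1 (k : R) : Rabs (vel k) <= 1.
Proof.
  generalize (covel_vel_sqr k) (pow2_ge_0 (covel k)) (pow2_abs (vel k)) (Rabs_pos (vel k)); nra.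
Qed.

Lemma Rabs_covel_le1 (k : R) : Rabs (covel k) <= 1.
Proof.
  generalize (covel_vel_sqr k) (pow2_ge_0 (vel k)) (pow2_abs (covel k)) (Rabs_pos (covel k)); nra.
Qed.

Definition weight (a b : R) (n l : nat) : R := ampL a b n l ^ 2 + ampR a b n l ^ 2.

Definition mean (w : nat -> nat -> R) (n : nat) (f : R -> R) : R :=
  sum_f_R0 (fun l => w n l * f (site n l / INR n)) n.

(** The coin is orthogonal, so each step preserves the sum of squares term by term. *)
Lemma weight_total (a b : R) (n : nat) :
  sum_f_R0 (weight a b n) n = a ^ 2 + b ^ 2.
Proof.
  induction n as [|n IH]; [reflexivity |].
  rewrite <- IH; clear IH; unfold weight.
  rewrite (sum_plus (fun l => ampL a b (S n) l ^ 2)).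
  rewrite (sum_eq _ (fun l => ampL a b (S n) l * ampL a b (S n) l)) by (intros; ring).
  rewrite sum_ampL.
  rewrite (sum_eq (fun l => ampR a b (S n) l ^ 2) (fun l => ampR a b (S n) l * ampR a b (S n) l)) by (intros; ring).
  rewrite sum_ampR, <- sum_plus; apply sum_eq; intros l _.
  rewrite ampL_S, ampR_S; generalize sqrt2_gt0 sqrt2_sqr; intros H1 H2.
  field_simplify_eq; [replace (sqrt 2 ^ 2) with 2 by lra; ring | lra].
Qed.

(** With J the matrix whose square is - I in the closed form of the transforms, the expectation of J
    in the state (a, b) is [- i vel k skew a b]. Besides the norm, this is all that the limit
    retains of the initial state. *)
Definition skew (a b : R) : R := a ^ 2 - b ^ 2 + 2 * a * b.

Definition corr2 (a b : R) (n : nat) (d tau k : R) : R :=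
  corr (ampL a b n) n d tau k + corr (ampR a b n) n d tau k.

Definition corr2_limit (a b xi tau k : R) : R :=
  cos tau * ((a ^ 2 + b ^ 2) * cos (xi * vel k)) - sin tau * (skew a b * vel k * sin (xi * vel k)).

(** An exact identity arranged so that, apart from the main terms in [t' - t], each term has a
    factor [vel (k + d) - vel k] or [covel (k + d) - covel k]. *)
Lemma corr2_formula (a b : R) (n : nat) (d tau k : R) :
  let t := INR n * phase k in let t' := INR n * phase (k + d) in
  corr2 a b n d tau k =
  cos tau * ((a ^ 2 + b ^ 2) * (cos (t' - t) + sin t * sin t' *
     (covel k * (covel (k + d) - covel k) + 2 * (vel k * (vel (k + d) - vel k)))))
  + sin tau * (- (skew a b * (vel k * sin (t' - t) + (vel (k + d) - vel k) * (cos t * sin t')))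
     + (b ^ 2 + 2 * a * b - a ^ 2) * (sin t * sin t' *
        (vel k * (covel (k + d) - covel k) - covel k * (vel (k + d) - vel k)))).
Proof.
  cbv zeta; unfold corr2, corr.
  destruct (fourier_formula a b n k) as (-> & -> & -> & ->).
  destruct (fourier_formula a b n (k + d)) as (-> & -> & -> & ->).
  rewrite cos_minus, sin_minus; unfold skew.
  generalize (covel_vel_sqr k).
  generalize (covel k) (vel k) (covel (k + d)) (vel (k + d))
    (cos (INR n * phase k)) (sin (INR n * phase k))
    (cos (INR n * phase (k + d))) (sin (INR n * phase (k + d))) (cos tau) (sin tau).
  intros p h p' h' C S C' S' ct st H.
  assert (H' : p ^ 2 = 1 - 2 * h ^ 2) by lra.
  ring_simplify; rewrite H'; ring.
Qed.

Lemma corr2_close (a b xi tau : R) :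
  exists K : R, forall (n : nat) (k : R), (0 < n)%nat ->
    Rabs (corr2 a b n (xi / INR n) tau k - corr2_limit a b xi tau k) <= K / INR n.
Proof.
  set (N := a ^ 2 + b ^ 2); set (q := skew a b).
  set (r := b ^ 2 + 2 * a * b - a ^ 2).
  (* The constant mirrors the shape of the difference, so that it is bounded factor by factor. *)
  exists (1 * (Rabs N * (xi ^ 2 + 1 * (1 * (2 * Rabs xi) + 2 * (1 * (1 * Rabs xi)))))
          + 1 * ((Rabs q * (1 * xi ^ 2 + (1 * Rabs xi) * 1))
              + Rabs r * (1 * (1 * (2 * Rabs xi) + 1 * (1 * Rabs xi))))).
  intros n k Hn.
  assert (Hn' : 0 < INR n) by (now apply lt_0_INR).
  rewrite corr2_formula; fold N q r.
  set (d := xi / INR n).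
  assert (Hd : Rabs d = Rabs xi / INR n).
  { unfold d, Rdiv; rewrite Rabs_mult, (Rabs_pos_eq (/ INR n)); [reflexivity |].
    now apply Rlt_le, Rinv_0_lt_compat. }
  set (t := INR n * phase k); set (t' := INR n * phase (k + d)).
  assert (Ht : Rabs ((t' - t) - xi * vel k) <= xi ^ 2 / INR n).
  { replace (t' - t - xi * vel k) with (INR n * (phase (k + d) - phase k - d * vel k))
      by (unfold t', t, d; field; lra).
    rewrite Rabs_mult, (Rabs_pos_eq (INR n)) by lra.
    replace (xi ^ 2 / INR n) with (INR n * d ^ 2) by (unfold d; field; lra).
    apply Rmult_le_compat_l; [lra | apply phase_increment]. }
  assert (Hp : Rabs (covel (k + d) - covel k) <= 2 * Rabs xi / INR n).
  { eapply Rle_trans; [apply covel_lip |]. replace (k + d - k) with d by ring. rewrite Hd; lra. }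
  assert (Hh : Rabs (vel (k + d) - vel k) <= 1 * Rabs xi / INR n).
  { eapply Rle_trans; [apply vel_lip |]. replace (k + d - k) with d by ring. rewrite Hd; lra. }
  unfold corr2_limit; fold N q.
  (* The difference is regrouped so that every summand shows one factor of order 1/n; the bound is
     regrouped below in the same shape. *)
  match goal with |- Rabs (?X) <= _ => replace X with
    (cos tau * (N * ((cos (t' - t) - cos (xi * vel k)) + (sin t * sin t') *
       (covel k * (covel (k + d) - covel k) + 2 * (vel k * (vel (k + d) - vel k)))))
    + sin tau * (- (q * (vel k * (sin (t' - t) - sin (xi * vel k)) + (vel (k + d) - vel k) * (cos t * sin t')))
       + r * ((sin t * sin t') *
        (vel k * (covel (k + d) - covel k) - covel k * (vel (k + d) - vel k)))))
    by (unfold r; ring) end.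
  assert (Hss : Rabs (sin t * sin t') <= 1).
  { replace 1 with (1 * 1) by ring; apply Rabs_mult_le; apply Rabs_sin_le1. }
  assert (Hcs : Rabs (cos t * sin t') <= 1).
  { replace 1 with (1 * 1) by ring; apply Rabs_mult_le; [apply Rabs_cos_le1 | apply Rabs_sin_le1]. }
  assert (Hc : Rabs (cos (t' - t) - cos (xi * vel k)) <= xi ^ 2 / INR n).
  { eapply Rle_trans; [apply cos_lip | lra]. }
  assert (Hs : Rabs (sin (t' - t) - sin (xi * vel k)) <= xi ^ 2 / INR n).
  { eapply Rle_trans; [apply sin_lip | lra]. }
  assert (Hadd : forall x y X Y, Rabs x <= X -> Rabs y <= Y -> Rabs (x + y) <= X + Y).
  { intros x y X Y HX HY; eapply Rle_trans; [apply Rabs_triang | lra]. }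
  match goal with |- _ <= ?X => replace X with
   (1 * (Rabs N * (xi ^ 2 / INR n + 1 * (1 * (2 * Rabs xi / INR n) + 2 * (1 * (1 * Rabs xi / INR n)))))
          + 1 * ((Rabs q * (1 * (xi ^ 2 / INR n) + (1 * Rabs xi / INR n) * 1))
              + Rabs r * (1 * (1 * (2 * Rabs xi / INR n) + 1 * (1 * Rabs xi / INR n))))) by (field; lra) end.
  assert (Hsub : forall x y X Y, Rabs x <= X -> Rabs y <= Y -> Rabs (x - y) <= X + Y).
  { intros x y X Y HX HY; unfold Rminus; apply Hadd; [exact HX | now rewrite Rabs_Ropp]. }
  assert (Hopp : forall x X, Rabs x <= X -> Rabs (- x) <= X).
  { intros x X HX; now rewrite Rabs_Ropp. }
  assert (H2 : Rabs 2 <= 2) by (rewrite Rabs_pos_eq; lra).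
  repeat first
    [ assumption | apply Hadd | apply Hsub | apply Hopp
    | apply Rabs_cos_le1 | apply Rabs_sin_le1 | apply Rabs_vel_le1 | apply Rabs_covel_le1
    | apply Rabs_mult_le | apply Rle_refl ].
Qed.

Lemma is_RInt_odd (f : R -> R) (c v : R) :
  (forall x, f (- x) = - f x) -> is_RInt f (- c) c v -> v = 0.
Proof.
  intros Hodd H.
  assert (H1 : is_RInt f (- c) c (- v)).
  { apply (is_RInt_swap (V := R_NormedModule) f).
    apply (is_RInt_ext (fun y => opp (f (- y)))).
    - intros y _; rewrite Hodd; apply Ropp_involutive.
    - apply (is_RInt_comp_opp (V := R_NormedModule)); now rewrite Ropp_involutive. }
  generalize (is_RInt_unique _ _ _ _ H) (is_RInt_unique _ _ _ _ H1); lra.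
Qed.

(** Integral of f against the image under [vel] of the density [(N - q * vel k) / PI]. *)
Definition limit_mean (N q : R) (f : R -> R) : R :=
  / PI * RInt (fun k => f (vel k) * (N - q * vel k)) (- (PI / 2)) (PI / 2).

Lemma continuous_vel (k : R) : continuous vel k.
Proof. apply (ex_derive_continuous (V := R_NormedModule)); eexists; apply is_derive_vel. Qed.

Lemma ex_RInt_vel (f : R -> R) (N q x y : R) :
  (forall z, continuous f z) -> ex_RInt (fun k => f (vel k) * (N - q * vel k)) x y.
Proof.
  intros Hf; apply (ex_RInt_continuous (V := R_CompleteNormedModule)); intros z _.
  apply (continuous_mult (K := R_AbsRing)).
  - apply continuous_comp; [apply continuous_vel | apply Hf].
  - apply (continuous_minus (V := R_NormedModule)); [apply continuous_const |].
    apply (continuous_mult (K := R_AbsRing)); [apply continuous_const | apply continuous_vel].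
Qed.

Lemma continuous_cos_affine (xi tau x : R) : continuous (fun x => cos (xi * x - tau)) x.
Proof. apply (ex_derive_continuous (V := R_NormedModule)); auto_derive; exact I. Qed.

Lemma vel_opp (k : R) : vel (- k) = - vel k.
Proof.
  unfold vel; rewrite sin_neg; replace ((- sin k) ^ 2) with (sin k ^ 2) by ring.
  unfold Rdiv; ring.
Qed.

(** Expanding [cos (xi * vel k - tau) * (N - q * vel k)] gives [corr2_limit] plus terms that are odd
    in k, because [vel] is odd; these integrate to 0. *)
Lemma is_RInt_corr2_limit (a b xi tau : R) :
  is_RInt (corr2_limit a b xi tau) (- (PI / 2)) (PI / 2)
    (PI * limit_mean (a ^ 2 + b ^ 2) (skew a b) (fun x => cos (xi * x - tau))).
Proof.
  generalize PI_RGT_0; intros HPI.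
  unfold limit_mean; rewrite <- Rmult_assoc, Rinv_r, Rmult_1_l by lra.
  set (N := a ^ 2 + b ^ 2); set (q := skew a b).
  set (g := fun k => cos (xi * vel k - tau) * (N - q * vel k)).
  assert (Hg : is_RInt g (- (PI / 2)) (PI / 2) (RInt g (- (PI / 2)) (PI / 2))).
  { apply (RInt_correct (V := R_CompleteNormedModule) g).
    apply (ex_RInt_vel (fun x => cos (xi * x - tau))), continuous_cos_affine. }
  set (o := fun k => corr2_limit a b xi tau k - g k).
  assert (Ho : ex_RInt o (- (PI / 2)) (PI / 2)).
  { apply (ex_RInt_minus (V := R_NormedModule)); [| eexists; apply Hg].
    apply (ex_RInt_continuous (V := R_CompleteNormedModule)); intros z _.
    apply (ex_derive_continuous (V := R_NormedModule)).
    unfold corr2_limit; auto_derive.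
    repeat split; eexists; apply is_derive_vel. }
  apply (RInt_correct (V := R_CompleteNormedModule)) in Ho.
  rewrite (is_RInt_odd o (PI / 2) (RInt o (- (PI / 2)) (PI / 2))) in Ho; [| | exact Ho].
  - replace (RInt g _ _) with (plus (RInt g (- (PI / 2)) (PI / 2)) 0) by apply Rplus_0_r.
    apply (is_RInt_ext (fun k => plus (g k) (o k))).
    + intros k _; unfold o, plus; simpl; ring.
    + now apply (is_RInt_plus (V := R_NormedModule)).
  - intros k; unfold o, g, corr2_limit; fold N q.
    rewrite vel_opp; rewrite !cos_minus.
    replace (xi * - vel k) with (- (xi * vel k)) by ring.
    rewrite cos_neg, sin_neg; ring.
Qed.

Lemma is_RInt_corr2 (a b xi tau : R) (n : nat) : (0 < n)%nat ->
  is_RInt (corr2 a b n (xi / INR n) tau) (- (PI / 2)) (PI / 2)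
    (PI * mean (weight a b) n (fun x => cos (xi * x - tau))).
Proof.
  intros Hn; assert (Hn' : 0 < INR n) by (now apply lt_0_INR).
  unfold corr2, mean, weight.
  rewrite (sum_eq _ (fun l => ampL a b n l ^ 2 * cos (xi / INR n * site n l - tau)
                              + ampR a b n l ^ 2 * cos (xi / INR n * site n l - tau))).
  - rewrite sum_plus, Rmult_plus_distr_l.
    apply (is_RInt_plus (V := R_NormedModule)); apply is_RInt_corr.
  - intros l _; replace (xi * (site n l / INR n)) with (xi / INR n * site n l) by (field; lra); ring.
Qed.

Lemma is_lim_seq_O_inv_n (u : nat -> R) (l K : R) :
  (forall n, (0 < n)%nat -> Rabs (u n - l) <= K / INR n) -> is_lim_seq u l.
Proof.
  intros H; apply is_lim_seq_incr_1.
  apply (is_lim_seq_le_le (fun n => l - K * / INR (S n)) _ (fun n => l + K * / INR (S n))).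
  - intros n; generalize (H (S n) (Nat.lt_0_succ n)); unfold Rdiv; intros H1.
    apply Rabs_le_between in H1; lra.
  - evar_last. 
    { apply is_lim_seq_minus'; [apply is_lim_seq_const |].
      apply (is_lim_seq_scal_l (fun n => / INR (S n)) K 0).
      apply (is_lim_seq_incr_1 (fun n => / INR n) 0).
      apply (is_lim_seq_inv INR p_infty); [apply is_lim_seq_INR | easy]. }
    simpl; f_equal; ring.
  - evar_last. 
    { apply is_lim_seq_plus'; [apply is_lim_seq_const |].
      apply (is_lim_seq_scal_l (fun n => / INR (S n)) K 0).
      apply (is_lim_seq_incr_1 (fun n => / INR n) 0).
      apply (is_lim_seq_inv INR p_infty); [apply is_lim_seq_INR | easy]. }
    simpl; f_equal; ring.
Qed.

(** Both sides are integrals over the same interval, and the integrands differ by at most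
    [K / INR n] uniformly in k. *)
Lemma mean_cos_lim (a b xi tau : R) :
  is_lim_seq (fun n => mean (weight a b) n (fun x => cos (xi * x - tau)))
    (limit_mean (a ^ 2 + b ^ 2) (skew a b) (fun x => cos (xi * x - tau))).
Proof.
  generalize PI_RGT_0; intros HPI.
  destruct (corr2_close a b xi tau) as [K HK].
  apply (is_lim_seq_O_inv_n _ _ K); intros n Hn.
  set (E := mean _ _ _); set (L := limit_mean _ _ _).
  assert (H : is_RInt (fun k => minus (corr2 a b n (xi / INR n) tau k) (corr2_limit a b xi tau k))
                (- (PI / 2)) (PI / 2) (minus (PI * E) (PI * L))).
  { apply (is_RInt_minus (V := R_NormedModule)).
    - now apply is_RInt_corr2.
    - apply is_RInt_corr2_limit. }
  apply (Rmult_le_reg_l PI); [exact HPI |].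
  replace (PI * Rabs (E - L)) with (Rabs (RInt (fun k => minus (corr2 a b n (xi / INR n) tau k) (corr2_limit a b xi tau k)) (- (PI / 2)) (PI / 2))).
  - replace (PI * (K / INR n)) with ((PI / 2 - - (PI / 2)) * (K / INR n)) by (f_equal; field).
    apply abs_RInt_le_const; [lra | eexists; apply H |].
    intros k _; now apply HK.
  - rewrite (is_RInt_unique _ _ _ _ H); unfold minus, plus, opp; simpl.
    replace (PI * E + - (PI * L)) with (PI * (E - L)) by ring.
    rewrite Rabs_mult, (Rabs_pos_eq PI); lra.
Qed.

(** * Test functions *)

Lemma mean_ext (w : nat -> nat -> R) (n : nat) (f g : R -> R) :
  (forall x, f x = g x) -> mean w n f = mean w n g.
Proof. intros H; apply sum_eq; intros; now rewrite H. Qed.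

Lemma mean_lin2 (w : nat -> nat -> R) (n : nat) (x y : R) (f g : R -> R) :
  mean w n (fun z => x * f z + y * g z) = x * mean w n f + y * mean w n g.
Proof. unfold mean; rewrite <- sum_lin2; apply sum_eq; intros; ring. Qed.

Lemma limit_mean_ext (N q : R) (f g : R -> R) :
  (forall x, f x = g x) -> limit_mean N q f = limit_mean N q g.
Proof. intros H; unfold limit_mean; f_equal; apply RInt_ext; intros; now rewrite H. Qed.

Lemma limit_mean_lin2 (N q x y : R) (f g : R -> R) :
  (forall z, continuous f z) -> (forall z, continuous g z) ->
  limit_mean N q (fun z => x * f z + y * g z) = x * limit_mean N q f + y * limit_mean N q g.
Proof.
  intros Hf Hg; unfold limit_mean.
  set (F := fun k => f (vel k) * (N - q * vel k)); set (G := fun k => g (vel k) * (N - q * vel k)).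
  assert (HF : is_RInt F (- (PI / 2)) (PI / 2) (RInt F (- (PI / 2)) (PI / 2)))
    by now apply (RInt_correct (V := R_CompleteNormedModule) F), ex_RInt_vel.
  assert (HG : is_RInt G (- (PI / 2)) (PI / 2) (RInt G (- (PI / 2)) (PI / 2)))
    by now apply (RInt_correct (V := R_CompleteNormedModule) G), ex_RInt_vel.
  rewrite (is_RInt_unique _ _ _ (x * RInt F (- (PI / 2)) (PI / 2) + y * RInt G (- (PI / 2)) (PI / 2))).
  - ring.
  - apply (is_RInt_ext (fun k => plus (scal x (F k)) (scal y (G k)))).
    + intros k _; unfold F, G, plus, scal; simpl; unfold mult; simpl; ring.
    + apply (is_RInt_plus (V := R_NormedModule));
        now apply (is_RInt_scal (V := R_NormedModule)).
Qed.

(** Convergence is demanded for all modulations of f, not for f alone: this is what makes the class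
    stable under multiplication by [sin]. The free [tau] covers sine and cosine waves at once. *)
Definition testable (w : nat -> nat -> R) (q : R) (f : R -> R) : Prop :=
  (forall x, continuous f x) /\
  forall xi tau, is_lim_seq (fun n => mean w n (fun x => f x * cos (xi * x - tau)))
    (limit_mean 1 q (fun x => f x * cos (xi * x - tau))).

(** Multipliers can be iterated, so powers stay available although products of testable functions
    are not known to be testable. *)
Definition multiplier (w : nat -> nat -> R) (q : R) (p : R -> R) : Prop :=
  forall f, testable w q f -> testable w q (fun x => p x * f x).

Lemma testable_ext (w : nat -> nat -> R) (q : R) (f g : R -> R) :
  (forall x, f x = g x) -> testable w q f -> testable w q g.
Proof.
  intros H [H1 H2]; split.
  - intros x; apply (continuous_ext f); auto.
  - intros xi tau; rewrite <- (limit_mean_ext _ _ (fun x => f x * cos (xi * x - tau)))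
      by (intros; now rewrite H).
    eapply is_lim_seq_ext; [| apply H2].
    intros n; apply mean_ext; intros; now rewrite H.
Qed.

Lemma testable_lin2 (w : nat -> nat -> R) (q x y : R) (f g : R -> R) :
  testable w q f -> testable w q g -> testable w q (fun z => x * f z + y * g z).
Proof.
  intros [F1 F2] [G1 G2]; split.
  - intros z; apply (continuous_plus (V := R_NormedModule));
      now apply (continuous_scal_r (V := R_NormedModule)).
  - intros xi tau.
    assert (C : forall h : R -> R, (forall z, continuous h z) ->
      forall z, continuous (fun z => h z * cos (xi * z - tau)) z).
    { intros h Hh z; apply (continuous_mult (K := R_AbsRing));
        [apply Hh | apply continuous_cos_affine]. }
    rewrite (limit_mean_ext _ _ _ (fun z => x * (f z * cos (xi * z - tau)) + y * (g z * cos (xi * z - tau))))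
      by (intros; ring).
    rewrite limit_mean_lin2 by now apply C.
    apply (is_lim_seq_ext (fun n => x * mean w n (fun z => f z * cos (xi * z - tau))
                                  + y * mean w n (fun z => g z * cos (xi * z - tau)))).
    + intros n; rewrite <- mean_lin2; apply mean_ext; intros; ring.
    + apply is_lim_seq_plus'.
      * apply (is_lim_seq_scal_l _ x (Finite _)), F2.
      * apply (is_lim_seq_scal_l _ y (Finite _)), G2.
Qed.

(** Product formula [2 sin z cos A = sin (A + z) - sin (A - z)]; adding [PI / 2] to [tau] turns
    these sines back into cosines. *)
Lemma multiplier_sin (w : nat -> nat -> R) (q : R) : multiplier w q sin.
Proof.
  intros f [H1 H2]; split.
  - intros z; apply (continuous_mult (K := R_AbsRing)); [apply continuous_sin | apply H1].
  - intros xi tau.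
    assert (E : forall z, sin z * f z * cos (xi * z - tau) =
      / 2 * (f z * cos ((xi + 1) * z - (tau + PI / 2))) + - / 2 * (f z * cos ((xi - 1) * z - (tau + PI / 2)))).
    { intros z.
      replace ((xi + 1) * z - (tau + PI / 2)) with ((xi * z - tau) + z - PI / 2) by ring.
      replace ((xi - 1) * z - (tau + PI / 2)) with ((xi * z - tau) - z - PI / 2) by ring.
      generalize (xi * z - tau); intros A.
      rewrite !(cos_minus _ (PI / 2)), cos_PI2, sin_PI2, sin_plus, sin_minus; field. }
    rewrite (limit_mean_ext _ _ _ _ E).
    eapply is_lim_seq_ext; [intros n; symmetry; apply mean_ext, E |].
    rewrite limit_mean_lin2 by
      (intros z; apply (continuous_mult (K := R_AbsRing)); [apply H1 | apply continuous_cos_affine]).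
    eapply is_lim_seq_ext; [intros n; symmetry; apply mean_lin2 |].
    apply is_lim_seq_plus'; apply (is_lim_seq_scal_l _ _ (Finite _)), H2.
Qed.

Lemma multiplier_affine (w : nat -> nat -> R) (q x y : R) (p : R -> R) :
  multiplier w q p -> multiplier w q (fun z => x + y * p z).
Proof.
  intros Hp f Hf.
  apply (testable_ext _ _ (fun z => x * f z + y * (p z * f z))); [intros; ring |].
  apply testable_lin2; [exact Hf | now apply Hp].
Qed.

Lemma multiplier_pow (w : nat -> nat -> R) (q : R) (p : R -> R) (n : nat) :
  multiplier w q p -> multiplier w q (fun z => p z ^ n).
Proof.
  intros Hp f Hf; induction n as [|n IH].
  - apply (testable_ext _ _ f); [intros; simpl; ring | exact Hf].
  - apply (testable_ext _ _ (fun z => p z * (p z ^ n * f z))); [intros; simpl; ring |].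
    now apply Hp.
Qed.

(** * Polynomial separation on the unit interval *)

Lemma pow_le_1 (x : R) (n : nat) : 0 <= x <= 1 -> x ^ n <= 1.
Proof. intros H; replace 1 with (1 ^ n) by apply pow1; now apply pow_incr. Qed.

Lemma one_minus_pow_ge (z : R) (M : nat) : 0 <= z <= 1 -> 1 - INR M * z <= (1 - z) ^ M.
Proof.
  intros Hz; induction M as [|M IH]; [simpl; lra |].
  rewrite S_INR; simpl.
  generalize (pow_le (1 - z) M ltac:(lra)) (pos_INR M); intros H1 H2.
  assert (INR M * z * z >= 0) by (apply Rle_ge; repeat apply Rmult_le_pos; lra).
  nra.
Qed.

(** Bernoulli bounds [1 + INR M * z] by [(1 + z) ^ M], and [(1 - z ^ 2) ^ M <= 1]. *)
Lemma one_minus_pow_le (z : R) (M : nat) : 0 <= z <= 1 -> (1 - z) ^ M * (INR M * z) <= 1.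
Proof.
  intros Hz.
  assert (H1 : 1 + INR M * z <= (1 + z) ^ M).
  { destruct (Req_dec z 0) as [->|Hz0].
    - rewrite Rplus_0_r, pow1; lra.
    - apply poly; lra. }
  assert (H2 : (1 - z) ^ M * (1 + z) ^ M <= 1).
  { rewrite <- Rpow_mult_distr; apply pow_le_1; nra. }
  generalize (pow_le (1 - z) M ltac:(lra)); nra.
Qed.

Lemma pow_small (x eps : R) : 0 <= x < 1 -> 0 < eps ->
  exists n0, forall n, (n0 <= n)%nat -> x ^ n <= eps.
Proof.
  intros Hx He; destruct (pow_lt_1_zero x) with (y := eps) as [n0 H]; [| exact He |].
  - rewrite Rabs_pos_eq; lra.
  - exists n0; intros n Hn; generalize (H n Hn); rewrite Rabs_pos_eq; [lra |].
    apply pow_le; lra.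
Qed.

Lemma pow_div (x y : R) (n : nat) : (x / y) ^ n = x ^ n * / y ^ n.
Proof. unfold Rdiv; now rewrite Rpow_mult_distr, pow_inv. Qed.

(* The polynomials [(1 - y^n)^M] with [M] close to [r^(-n)] separate [y < r] from [y > r]. *)
Lemma pow_separation (y1 y2 eps : R) : 0 <= y1 < y2 -> y2 <= 1 -> 0 < eps ->
  exists n M : nat,
    (forall y, 0 <= y <= y1 -> 1 - eps <= (1 - y ^ n) ^ M) /\
    (forall y, y2 <= y <= 1 -> (1 - y ^ n) ^ M <= eps).
Proof.
  intros Hy Hy2 He; set (r := (y1 + y2) / 2).
  assert (Hr : y1 < r < y2) by (unfold r; lra).
  (* As r lies strictly between y1 and y2, both ratios have powers tending to 0; [eps / 2] absorbs
     the factor 2 lost when M is rounded. *)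
  destruct (pow_small (y1 / r) (eps / 2)) as [n1 H1]; [split; [| apply Rlt_div_l; lra] | lra |].
  { apply Rmult_le_pos; [lra | apply Rlt_le, Rinv_0_lt_compat; lra]. }
  destruct (pow_small (r / y2) eps) as [n2 H2]; [split; [| apply Rlt_div_l; lra] | lra |].
  { apply Rmult_le_pos; [lra | apply Rlt_le, Rinv_0_lt_compat; lra]. }
  set (n := Nat.max n1 n2).
  specialize (H1 n (Nat.le_max_l _ _)); specialize (H2 n (Nat.le_max_r _ _)).
  assert (Hrn : 0 < r ^ n <= 1).
  { split; [apply pow_lt; lra | apply pow_le_1; lra]. }
  assert (Hy2n : 0 < y2 ^ n) by (apply pow_lt; lra).
  set (R0 := / r ^ n) in *.
  assert (HR0 : 1 <= R0) by (unfold R0; rewrite <- Rinv_1; apply Rinv_le_contravar; lra).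
  assert (HR1 : r ^ n * R0 = 1) by (unfold R0; field; lra).
  destruct (nfloor_ex R0) as [M0 HM]; [lra |].
  exists n, (S M0).
  (* Rounding up adds at most 1, which is at most [R0]. *)
  assert (HM' : R0 <= INR (S M0) <= 2 * R0) by (rewrite S_INR; lra).
  rewrite pow_div in H1, H2.
  split; intros y Hyy.
  - assert (Hyn : 0 <= y ^ n <= y1 ^ n) by (split; [apply pow_le; lra | apply pow_incr; lra]).
    assert (Hy1n : y1 ^ n <= 1) by (apply pow_le_1; lra).
    eapply Rle_trans; [| apply one_minus_pow_ge; lra].
    fold R0 in H1.
    assert (INR (S M0) * y ^ n <= 2 * R0 * y1 ^ n) by (apply Rmult_le_compat; try lra; apply pos_INR).
    lra.
  - assert (Hyn : y2 ^ n <= y ^ n) by (apply pow_incr; lra).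
    assert (Hyn1 : y ^ n <= 1) by (apply pow_le_1; lra).
    generalize (one_minus_pow_le (y ^ n) (S M0) ltac:(lra)); intros H.
    assert (HP : 0 <= (1 - y ^ n) ^ S M0) by (apply pow_le; lra).
    set (P := (1 - y ^ n) ^ S M0) in *.
    assert (H3 : R0 * y2 ^ n <= INR (S M0) * y ^ n) by (apply Rmult_le_compat; lra).
    assert (H4 : P * (R0 * y2 ^ n) <= 1).
    { eapply Rle_trans; [| exact H]; now apply Rmult_le_compat_l. }
    eapply Rle_trans; [| exact H2].
    apply (Rmult_le_reg_r (R0 * y2 ^ n)); [apply Rmult_lt_0_compat; lra |].
    replace (r ^ n * / y2 ^ n * (R0 * y2 ^ n)) with 1; [exact H4 |].
    unfold R0; field; lra.
Qed.

Lemma sin_lt_unit (x y : R) : -1 <= x -> x < y -> y <= 1 -> sin x < sin y.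
Proof. intros; generalize PI2_1; intros; apply sin_increasing_1; lra. Qed.

Lemma testable_separation (w : nat -> nat -> R) (q t1 t2 eps : R) :
  testable w q (fun _ => 1) -> -1 <= t1 < t2 -> t2 <= 1 -> 0 < eps ->
  exists f, testable w q f /\
    (forall x, 0 <= f x <= 1) /\
    (forall x, -1 <= x <= t1 -> 1 - eps <= f x) /\
    (forall x, t2 <= x <= 1 -> f x <= eps).
Proof.
  intros H1 Ht Ht2 He.
  (* Takes values in [0, 1] on the whole line, which gives the global bounds on f, and increases
     strictly on [-1, 1] because 1 < [PI / 2]. *)
  set (y := fun x => / 2 + / 2 * sin x).
  assert (Hy : forall x, 0 <= y x <= 1) by (intros x; unfold y; generalize (SIN_bound x); lra).
  assert (Hlt : forall a b, -1 <= a -> a < b -> b <= 1 -> y a < y b).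
  { intros a b Ha Hab Hb; unfold y; generalize (sin_lt_unit a b Ha Hab Hb); lra. }
  assert (Hle : forall a b, -1 <= a -> a <= b -> b <= 1 -> y a <= y b).
  { intros a b Ha [Hab|Hab] Hb; [left; auto | subst; lra]. }
  destruct (pow_separation (y t1) (y t2) eps) as (n & M & A & B).
  { split; [apply Hy | apply Hlt; lra]. }
  { apply Hy. }
  { exact He. }
  exists (fun x => (1 - y x ^ n) ^ M); split; [| split; [| split]].
  - apply (testable_ext _ _ (fun x => (1 + -1 * y x ^ n) ^ M * 1)).
    { intros x; rewrite Rmult_1_r; f_equal; ring. }
    apply (multiplier_pow w q (fun x => 1 + -1 * y x ^ n)); [| exact H1].
    apply (multiplier_affine w q), multiplier_pow, multiplier_affine, multiplier_sin.
  - intros x; assert (0 <= y x ^ n <= 1).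
    { split; [apply pow_le, Hy | apply pow_le_1, Hy]. }
    split; [apply pow_le; lra | apply pow_le_1; lra].
  - intros x Hx; apply A; split; [apply Hy | apply Hle; lra].
  - intros x Hx; apply B; split; [apply Hle; lra | apply Hy].
Qed.

(** * Distribution functions *)

(** A composition of increasing functions on the half period, which gives monotonicity of [vel]
    without its derivative. *)
Lemma vel_sin_atan (k : R) : vel k = sin (atan (sin k)).
Proof. rewrite sin_atan; unfold vel, Rsqr; do 3 f_equal; ring. Qed.

Lemma vel_lt (x y : R) : - (PI / 2) <= x -> x < y -> y <= PI / 2 -> vel x < vel y.
Proof.
  intros Hx Hxy Hy; rewrite !vel_sin_atan.
  generalize (atan_bound (sin x)) (atan_bound (sin y)); intros Bx By.
  apply sin_increasing_1; try lra.
  apply atan_increasing, sin_increasing_1; lra.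
Qed.

(** Since [phase' = vel], the density [(1 - q * vel k) / PI] has this elementary antiderivative. It
    is not normalised at [- (PI / 2)]; only increments matter. *)
Definition cdf (q k : R) : R := (k - q * phase k) / PI.

Lemma is_derive_cdf (q k : R) : is_derive (cdf q) k ((1 - q * vel k) / PI).
Proof.
  generalize PI_RGT_0; intros HPI; unfold cdf.
  evar_last.
  { auto_derive; [eexists; apply is_derive_phase | reflexivity]. }
  simpl; replace (Derive (fun x => phase x) k) with (vel k)
    by (symmetry; apply is_derive_unique, is_derive_phase).
  field; lra.
Qed.

Lemma RInt_density (q x y : R) :
  is_RInt (fun k => 1 - q * vel k) x y (PI * (cdf q y - cdf q x)).
Proof.
  generalize PI_RGT_0; intros HPI.
  apply (is_RInt_ext (fun k => scal PI ((1 - q * vel k) / PI))).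
  { intros k _; unfold scal; simpl; unfold mult; simpl; field; lra. }
  apply (is_RInt_scal (V := R_NormedModule)).
  apply (is_RInt_derive (V := R_CompleteNormedModule) (cdf q)).
  - intros k _; apply is_derive_cdf.
  - intros k _; apply (ex_derive_continuous (V := R_NormedModule)).
    auto_derive; eexists; apply is_derive_vel.
Qed.

Lemma density_bounds (q k : R) : -1 <= q <= 1 -> 0 <= 1 - q * vel k <= 2.
Proof.
  intros Hq; assert (H : Rabs (q * vel k) <= 1 * 1).
  { apply Rabs_mult_le; [apply Rabs_le; lra | apply Rabs_vel_le1]. }
  apply Rabs_le_between in H; lra.
Qed.

Lemma PI_gt2 : 2 < PI.
Proof. generalize PI2_1; lra. Qed.

(** The density lies between 0 and [2 / PI], and 2 < [PI] gives the Lipschitz constant 1. *)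
Lemma cdf_incr (q x y : R) : -1 <= q <= 1 -> x <= y -> cdf q x <= cdf q y <= cdf q x + (y - x).
Proof.
  intros Hq Hxy; generalize PI_gt2; intros HPI.
  assert (H1 : RInt (fun _ => 0) x y <= PI * (cdf q y - cdf q x)).
  { rewrite <- (is_RInt_unique _ _ _ _ (RInt_density q x y)).
    apply RInt_le; [exact Hxy | apply ex_RInt_const | eexists; apply RInt_density |].
    intros k _; now apply density_bounds. }
  assert (H2 : PI * (cdf q y - cdf q x) <= RInt (fun _ => 2) x y).
  { rewrite <- (is_RInt_unique _ _ _ _ (RInt_density q x y)).
    apply RInt_le; [exact Hxy | eexists; apply RInt_density | apply ex_RInt_const |].
    intros k _; now apply density_bounds. }
  rewrite RInt_const in H1, H2.
  unfold scal in H1, H2; simpl in H1, H2; unfold mult in H1, H2; simpl in H1, H2.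
  split; nra.
Qed.

(** [covel] vanishes at both ends, so [phase] takes the same value there and the term in q
    cancels. *)
Lemma cdf_total (q : R) : cdf q (PI / 2) - cdf q (- (PI / 2)) = 1.
Proof.
  generalize PI_RGT_0; intros HPI.
  assert (H1 : covel (PI / 2) = 0) by (unfold covel; rewrite cos_PI2; unfold Rdiv; ring).
  assert (H2 : covel (- (PI / 2)) = 0)
    by (unfold covel; rewrite cos_neg, cos_PI2; unfold Rdiv; ring).
  unfold cdf, phase; rewrite H1, H2; field; lra.
Qed.

Lemma RInt_vel_const_le (q c x y : R) (f : R -> R) :
  -1 <= q <= 1 -> x <= y -> (forall z, continuous f z) ->
  (forall k, x < k < y -> f (vel k) <= c) ->
  RInt (fun k => f (vel k) * (1 - q * vel k)) x y <= PI * (c * (cdf q y - cdf q x)).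
Proof.
  intros Hq Hxy Hf Hc.
  assert (H : is_RInt (fun k => scal c (1 - q * vel k)) x y (scal c (PI * (cdf q y - cdf q x))))
    by apply (is_RInt_scal (V := R_NormedModule)), RInt_density.
  replace (PI * (c * (cdf q y - cdf q x))) with (scal c (PI * (cdf q y - cdf q x)))
    by (unfold scal; simpl; unfold mult; simpl; ring).
  rewrite <- (is_RInt_unique _ _ _ _ H).
  apply RInt_le; [exact Hxy | now apply ex_RInt_vel | eexists; apply H |].
  intros k Hk; apply Rmult_le_compat_r; [now apply density_bounds | now apply Hc].
Qed.

(** The integral is split at k: as [vel] increases, its values on either side satisfy one of the two
    bounds. *)
Lemma limit_mean_le (q k c1 c2 : R) (f : R -> R) :
  -1 <= q <= 1 -> - (PI / 2) <= k <= PI / 2 -> (forall x, continuous f x) ->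
  (forall x, -1 <= x <= vel k -> f x <= c1) -> (forall x, vel k <= x <= 1 -> f x <= c2) ->
  limit_mean 1 q f <=
    c1 * (cdf q k - cdf q (- (PI / 2))) + c2 * (cdf q (PI / 2) - cdf q k).
Proof.
  intros Hq Hk Hf H1 H2; generalize PI_RGT_0; intros HPI; unfold limit_mean.
  rewrite <- (RInt_Chasles (V := R_CompleteNormedModule) _ _ k) by now apply ex_RInt_vel.
  unfold plus; simpl.
  apply (Rmult_le_reg_l PI); [exact HPI |].
  rewrite <- Rmult_assoc, Rinv_r, Rmult_1_l by lra.
  rewrite Rmult_plus_distr_l; apply Rplus_le_compat; apply RInt_vel_const_le; try lra; try assumption.
  all: intros t Ht; generalize (Rabs_vel_le1 t); intros H; apply Rabs_le_between in H.
  - apply H1; split; [lra | apply Rlt_le, vel_lt; lra].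
  - apply H2; split; [apply Rlt_le, vel_lt; lra | lra].
Qed.

Lemma limit_mean_ge (q k c1 c2 : R) (f : R -> R) :
  -1 <= q <= 1 -> - (PI / 2) <= k <= PI / 2 -> (forall x, continuous f x) ->
  (forall x, -1 <= x <= vel k -> c1 <= f x) -> (forall x, vel k <= x <= 1 -> c2 <= f x) ->
  c1 * (cdf q k - cdf q (- (PI / 2))) + c2 * (cdf q (PI / 2) - cdf q k) <= limit_mean 1 q f.
Proof.
  intros Hq Hk Hf H1 H2.
  (* The upper bound is applied to the negative of f, written in the shape of [limit_mean_lin2]. *)
  assert (C : forall x, continuous (fun x => -1 * f x + 0 * f x) x).
  { intros x; apply (continuous_plus (V := R_NormedModule));
      now apply (continuous_scal_r (V := R_NormedModule)). }
  generalize (limit_mean_le q k (- c1) (- c2) (fun x => -1 * f x + 0 * f x) Hq Hk C).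
  rewrite limit_mean_lin2 by assumption.
  intros H; cut (-1 * limit_mean 1 q f + 0 * limit_mean 1 q f <=
    - c1 * (cdf q k - cdf q (- (PI / 2))) + - c2 * (cdf q (PI / 2) - cdf q k)); [lra |].
  apply H; intros x Hx; [generalize (H1 x Hx) | generalize (H2 x Hx)]; lra.
Qed.

Lemma mean_le (w : nat -> nat -> R) (n : nat) (f g : R -> R) (eps : R) :
  (forall l, (l <= n)%nat -> 0 <= w n l) -> sum_f_R0 (w n) n = 1 ->
  (forall x, -1 <= x <= 1 -> f x <= g x + eps) ->
  mean w n f <= mean w n g + eps.
Proof.
  intros H0 H1 Hfg; rewrite <- (Rmult_1_r eps), <- H1, <- sum_scal; unfold mean.
  rewrite <- sum_plus; apply sum_Rle; intros l Hl.
  replace (w n l * g (site n l / INR n) + eps * w n l) with (w n l * (g (site n l / INR n) + eps)) by ring.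
  apply Rmult_le_compat_l; [now apply H0 | apply Hfg].
  apply le_INR in Hl; generalize (pos_INR l); unfold site; intros Hl0.
  (* At time 0 the quotient is [0 / 0], which evaluates to 0 and so still lies in [-1, 1]. *)
  destruct n as [|n].
  - replace (INR l) with 0 by (simpl in *; lra); simpl; lra.
  - assert (Hn : 0 < INR (S n)) by (apply lt_0_INR; lia).
    split; [apply Rle_div_r | apply Rle_div_l]; lra.
Qed.

(** The value of chi at t is left free, so open and closed half-lines are treated together; the
    limit has no atoms because [cdf] is continuous. The threshold enters through the two
    inequalities on [vel] rather than [vel k0 = t], which admits a t outside the range of [vel]. *)
Lemma mean_threshold_lim (w : nat -> nat -> R) (q t k0 : R) (chi : R -> R) :
  (forall n l, (l <= n)%nat -> 0 <= w n l) -> (forall n, sum_f_R0 (w n) n = 1) ->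
  -1 <= q <= 1 -> testable w q (fun _ => 1) ->
  (forall x, 0 <= chi x <= 1) -> (forall x, x < t -> chi x = 1) -> (forall x, t < x -> chi x = 0) ->
  - (PI / 2) <= k0 <= PI / 2 ->
  (forall k, - (PI / 2) <= k < k0 -> vel k < t) -> (forall k, k0 < k <= PI / 2 -> t < vel k) ->
  is_lim_seq (fun n => mean w n chi) (cdf q k0 - cdf q (- (PI / 2))).
Proof.
  intros w_ge0 w_1 Hq H1 Hchi Hlt Hgt Hk0 Hbelow Habove.
  generalize PI_gt2 (cdf_total q); intros HPI Htot.
  set (L := cdf q k0 - cdf q (- (PI / 2))).
  assert (HL : 0 <= L <= 1).
  { unfold L; generalize (cdf_incr q (- (PI / 2)) k0 Hq ltac:(lra)) (cdf_incr q k0 (PI / 2) Hq ltac:(lra)); lra. }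
  assert (vel_in : forall k, -1 <= vel k <= 1).
  { intros k; apply Rabs_le_between, Rabs_vel_le1. }
  assert (const_mean : forall n c, mean w n (fun _ => c) = c).
  { intros n c; unfold mean. rewrite (sum_eq _ (fun l => c * w n l)) by (intros; ring).
    rewrite sum_scal, w_1; ring. }
  assert (testable_lim : forall f, testable w q f -> is_lim_seq (fun n => mean w n f) (limit_mean 1 q f)).
  { intros f [_ Hf]; specialize (Hf 0 0).
    assert (E : forall x, f x * cos (0 * x - 0) = f x).
    { intros x; replace (0 * x - 0) with 0 by ring; rewrite cos_0; ring. }
    rewrite (limit_mean_ext _ _ _ _ E) in Hf.
    eapply is_lim_seq_ext; [| exact Hf]; intros n; now apply mean_ext. }
  assert (upper : forall eps, 0 < eps -> eventually (fun n => mean w n chi <= L + 4 * eps)).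
  { intros eps He; destruct (Req_dec k0 (PI / 2)) as [E | Hk].
    - exists 0%nat; intros n _; unfold L; rewrite E, Htot.
      generalize (mean_le w n chi (fun _ => 1) 0 (w_ge0 n) (w_1 n) ltac:(intros; generalize (Hchi x); lra)).
      rewrite const_mean; lra.
    (* Moving to the right of k0 leaves room between t and [vel k1] for a test function, at a cost
       of at most eps in [cdf]. The four eps are: this shift, the values of f beyond [vel k1], the
       convergence of the mean of f, and the comparison of chi with f. *)
    - set (k1 := Rmin (k0 + eps) (PI / 2)).
      assert (Hk1 : k0 < k1 <= PI / 2 /\ k1 <= k0 + eps) by (unfold k1, Rmin; destruct (Rle_dec _ _); lra).
      generalize (Habove k1 ltac:(lra)) (vel_lt (- (PI / 2)) k1); intros Hv Hm1.
      generalize (vel_in (- (PI / 2))) (vel_in k1); intros B1 B2.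
      (* The separation works inside [-1, 1], whereas t may lie below -1. *)
      destruct (testable_separation w q (Rmax t (-1)) (vel k1) eps) as (f & Tf & f01 & fl & fr); auto.
      { split; [apply Rmax_r | apply Rmax_lub_lt; lra]. }
      { lra. }
      assert (lim_f : limit_mean 1 q f <= L + 2 * eps).
      { eapply Rle_trans; [apply (limit_mean_le q k1 1 eps); auto; try lra; [apply Tf | intros; apply f01] |].
        generalize (cdf_incr q k0 k1 Hq ltac:(lra)) (cdf_incr q k1 (PI / 2) Hq ltac:(lra))
           (cdf_incr q (- (PI / 2)) k1 Hq ltac:(lra)); unfold L; intros; nra. }
      generalize (testable_lim f Tf); intros Hf.
      apply is_lim_seq_spec in Hf; destruct (Hf (mkposreal eps He)) as [n0 Hn0].
      exists n0; intros n Hn; specialize (Hn0 n Hn); simpl in Hn0.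
      apply Rabs_lt_between in Hn0.
      assert (mean w n chi <= mean w n f + eps); [| lra].
      apply mean_le; auto; intros x Hx; destruct (Rle_lt_dec x t) as [Hxt | Hxt].
      + generalize (Hchi x) (fl x (conj (proj1 Hx) (Rle_trans _ _ _ Hxt (Rmax_l _ _)))); lra.
      + rewrite Hgt by exact Hxt; generalize (f01 x); lra. }
  assert (lower : forall eps, 0 < eps -> eventually (fun n => L - 4 * eps <= mean w n chi)).
  { intros eps He; destruct (Req_dec k0 (- (PI / 2))) as [E | Hk].
    - exists 0%nat; intros n _; unfold L; rewrite E.
      generalize (mean_le w n (fun _ => 0) chi 0 (w_ge0 n) (w_1 n) ltac:(intros; generalize (Hchi x); lra)).
      rewrite const_mean; lra.
    - set (k1 := Rmax (k0 - eps) (- (PI / 2))).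
      assert (Hk1 : - (PI / 2) <= k1 < k0 /\ k0 - eps <= k1) by (unfold k1, Rmax; destruct (Rle_dec _ _); lra).
      generalize (Hbelow k1 ltac:(lra)) (vel_lt k1 (PI / 2)); intros Hv Hm1.
      generalize (vel_in (PI / 2)) (vel_in k1); intros B1 B2.
      destruct (testable_separation w q (vel k1) (Rmin t 1) eps) as (f & Tf & f01 & fl & fr); auto.
      { split; [lra | apply Rmin_glb_lt; lra]. }
      { apply Rmin_r. }
      assert (lim_f : L - 2 * eps <= limit_mean 1 q f).
      { eapply Rle_trans; [| apply (limit_mean_ge q k1 (1 - eps) 0); auto; try lra; [apply Tf | intros; apply f01]].
        generalize (cdf_incr q k1 k0 Hq ltac:(lra)) (cdf_incr q k1 (PI / 2) Hq ltac:(lra))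
           (cdf_incr q (- (PI / 2)) k1 Hq ltac:(lra)); unfold L; intros; nra. }
      generalize (testable_lim f Tf); intros Hf.
      apply is_lim_seq_spec in Hf; destruct (Hf (mkposreal eps He)) as [n0 Hn0].
      exists n0; intros n Hn; specialize (Hn0 n Hn); simpl in Hn0.
      apply Rabs_lt_between in Hn0.
      assert (mean w n f <= mean w n chi + eps); [| lra].
      apply mean_le; auto; intros x Hx; destruct (Rlt_le_dec x t) as [Hxt | Hxt].
      + rewrite Hlt by exact Hxt; generalize (f01 x); lra.
      + generalize (Hchi x) (fr x (conj (Rle_trans _ _ _ (Rmin_l _ _) Hxt) (proj2 Hx))); lra. }
  apply is_lim_seq_spec; intros [eps He]; simpl.
  destruct (upper (eps / 5)) as [n1 Hn1]; [lra |].
  destruct (lower (eps / 5)) as [n2 Hn2]; [lra |].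
  exists (Nat.max n1 n2); intros n Hn.
  specialize (Hn1 n ltac:(lia)); specialize (Hn2 n ltac:(lia)).
  apply Rabs_lt_between; lra.
Qed.

(** * Removal of the environment *)

Fixpoint gauge_up (omega : Z -> R) (n : nat) : R :=
  match n with O => 0 | S n' => gauge_up omega n' - omega (Z.of_nat n) end.

Fixpoint gauge_down (omega : Z -> R) (n : nat) : R :=
  match n with O => 0 | S n' => gauge_down omega n' + omega (- Z.of_nat n')%Z end.

(** The recurrence is solved upwards and downwards from 0; [gauge_down omega n] is the value at the
    site -n. *)
Lemma gauge_exists (omega : Z -> R) :
  exists alpha : Z -> R, alpha 0%Z = 0 /\ forall x, alpha x = alpha (x - 1)%Z - omega x.
Proof.
  exists (fun z => if Z_le_dec 0 z then gauge_up omega (Z.to_nat z)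
                   else gauge_down omega (Z.to_nat (- z))).
  split; [reflexivity |]; intros x.
  destruct (Z_le_dec 0 x) as [H | H], (Z_le_dec 0 (x - 1)) as [H' | H']; try lia.
  - replace (Z.to_nat x) with (S (Z.to_nat (x - 1))) by lia; simpl.
    do 2 f_equal; lia.
  - replace x with 0%Z by lia; simpl; ring.
  - replace (Z.to_nat (- (x - 1))) with (S (Z.to_nat (- x))) by lia; simpl.
    replace (- Z.of_nat (Z.to_nat (- x)))%Z with x by lia; ring.
Qed.

Definition cis (t : R) : Cx := mkCx (cos t) (sin t).

Definition Vadd (v w : V2) : V2 := mkV2 (Cadd (v1 v) (v1 w)) (Cadd (v2 v) (v2 w)).

Lemma Mapp_Madd (A B : M2) (v : V2) : Mapp (Madd A B) v = Vadd (Mapp A v) (Mapp B v).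
Proof. unfold Mapp, Madd, Vadd, Cadd, Cmul; simpl; f_equal; f_equal; ring. Qed.

Lemma Mapp_Mmul (A B : M2) (v : V2) : Mapp (Mmul A B) v = Mapp A (Mapp B v).
Proof. unfold Mapp, Mmul, Cadd, Cmul; simpl; f_equal; f_equal; ring. Qed.

(** The shift to [x - 1] in the second component compensates the coin phase, as
    [omega x = alpha (x - 1) - alpha x]. The factor (-1)^m, one sign per right step, turns the
    second coin row (1, -1) into (-1, 1). *)
Definition gauged (alpha : Z -> R) (x : Z) (m : nat) (z w : Cx) : V2 :=
  mkV2 (Cmul (cis (alpha x + INR m * PI)) z) (Cmul (cis (alpha (x - 1)%Z + INR m * PI)) w).

Lemma Mapp_Pm_gauged (omega alpha : Z -> R) (x : Z) (m : nat) (z w : Cx) :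
  (forall x, alpha x = alpha (x - 1)%Z - omega x) ->
  Mapp (Pm omega (x + 1)) (gauged alpha (x + 1) m z w) =
  gauged alpha x m (mkCx ((re z + re w) / sqrt 2) ((im z + im w) / sqrt 2)) C0.
Proof.
  intros Ha; unfold gauged, Mapp, Pm, a_, b_, cis, Cmul, Cadd, C0; simpl.
  replace (x + 1 - 1)%Z with x by ring.
  replace (omega (x + 1)%Z) with (alpha x - alpha (x + 1)%Z)
    by (rewrite (Ha (x + 1)%Z); replace (x + 1 - 1)%Z with x by ring; ring).
  set (A := alpha (x + 1)%Z + INR m * PI).
  replace (alpha x + INR m * PI) with ((alpha x - alpha (x + 1)%Z) + A) by (unfold A; ring).
  rewrite cos_plus, sin_plus.
  f_equal; f_equal; unfold Rdiv; ring.
Qed.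

Lemma Mapp_Qm_gauged (omega alpha : Z -> R) (x : Z) (m : nat) (z w : Cx) :
  (forall x, alpha x = alpha (x - 1)%Z - omega x) ->
  Mapp (Qm omega (x - 1)) (gauged alpha (x - 1) m z w) =
  gauged alpha x (S m) C0 (mkCx ((re w - re z) / sqrt 2) ((im w - im z) / sqrt 2)).
Proof.
  intros Ha; unfold gauged, Mapp, Qm, c_, d_, cis, Cmul, Cadd, C0; cbn [re im v1 v2 e11 e12 e21 e22].
  replace (omega (x - 1)%Z) with (alpha (x - 1 - 1)%Z - alpha (x - 1)%Z)
    by (rewrite (Ha (x - 1)%Z); ring).
  rewrite S_INR, Rmult_plus_distr_r, Rmult_1_l, <- !Rplus_assoc, !neg_cos, !neg_sin.
  set (A := alpha (x - 1)%Z + INR m * PI).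
  replace (alpha (x - 1 - 1)%Z + INR m * PI)
    with ((alpha (x - 1 - 1)%Z - alpha (x - 1)%Z) + A) by (unfold A; ring).
  rewrite cos_plus, sin_plus.
  generalize (sin2_cos2 (alpha (x - 1 - 1)%Z - alpha (x - 1)%Z)); unfold Rsqr.
  generalize (cos (alpha (x - 1 - 1)%Z - alpha (x - 1)%Z)) (sin (alpha (x - 1 - 1)%Z - alpha (x - 1)%Z)).
  generalize (cos A) (sin A).
  intros C S c s H; assert (H' : c * c = 1 - s * s) by lra.
  f_equal; f_equal; unfold Rdiv; ring_simplify;
    replace (c ^ 2) with (1 - s * s) by lra; ring.
Qed.

Lemma Vadd_gauged (alpha : Z -> R) (x : Z) (m : nat) (z w : Cx) :
  Vadd (gauged alpha x m z C0) (gauged alpha x m C0 w) = gauged alpha x m z w.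
Proof. unfold Vadd, gauged, Cadd, Cmul, C0; simpl; f_equal; [f_equal | destruct w; simpl; f_equal]; ring. Qed.

Definition ampL2 (a1 b1 a2 b2 : R) (n l : nat) : Cx := mkCx (ampL a1 b1 n l) (ampL a2 b2 n l).
Definition ampR2 (a1 b1 a2 b2 : R) (n l : nat) : Cx := mkCx (ampR a1 b1 n l) (ampR a2 b2 n l).

Lemma Xi_SO (omega : Z -> R) (l : nat) :
  Xi omega (S l) 0 = Mmul (Pm omega (Z.of_nat 0 - Z.of_nat (S l) + 1)) (Xi omega l 0).
Proof. reflexivity. Qed.

Lemma Xi_OS (omega : Z -> R) (m : nat) :
  Xi omega 0 (S m) = Mmul (Qm omega (Z.of_nat (S m) - Z.of_nat 0 - 1)) (Xi omega 0 m).
Proof. reflexivity. Qed.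

Lemma Xi_SS (omega : Z -> R) (l m : nat) :
  Xi omega (S l) (S m) =
  Madd (Mmul (Pm omega (Z.of_nat (S m) - Z.of_nat (S l) + 1)) (Xi omega l (S m)))
       (Mmul (Qm omega (Z.of_nat (S m) - Z.of_nat (S l) - 1)) (Xi omega (S l) m)).
Proof. reflexivity. Qed.

(* The phases [alpha] remove the environment; only [omega 0] survives, in the initial state
   [(1, sin (omega 0) + i cos (omega 0)) / sqrt 2]. *)
Lemma Xi_gauged (omega alpha : Z -> R) (l m : nat) :
  alpha 0%Z = 0 -> (forall x, alpha x = alpha (x - 1)%Z - omega x) ->
  let a1 := 1 / sqrt 2 in let b1 := sin (omega 0%Z) / sqrt 2 in
  let b2 := cos (omega 0%Z) / sqrt 2 in
  Mapp (Xi omega l m) phi_star =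
  gauged alpha (Z.of_nat m - Z.of_nat l) m
    (ampL2 a1 b1 0 b2 (l + m) l) (ampR2 a1 b1 0 b2 (l + m) l).
Proof.
  intros Ha0 Ha a1 b1 b2; revert m; induction l as [|l IHl]; intros m.
  - induction m as [|m IHm].
    + unfold gauged; simpl Z.of_nat; simpl Z.sub; rewrite Ha0.
      (* Here [omega 0] enters: the second component of [phi_star] is [exp (i omega 0)] times [(sin
         (omega 0) + i cos (omega 0)) / sqrt 2]. *)
      replace (alpha (-1)%Z) with (omega 0%Z) by (generalize (Ha 0%Z); simpl; lra).
      unfold Mapp, phi_star, cis, Cmul, Cadd, ampL2, ampR2, ampL, ampR; simpl.
      replace (0 + 0 * PI) with 0 by ring; replace (omega 0%Z + 0 * PI) with (omega 0%Z) by ring.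
      rewrite cos_0, sin_0; generalize (sin2_cos2 (omega 0%Z)); unfold Rsqr; intros H.
      f_equal; f_equal; unfold b1, b2, a1, Rdiv; try ring.
      replace (cos (omega 0%Z) * (cos (omega 0%Z) * / sqrt 2) + sin (omega 0%Z) * (sin (omega 0%Z) * / sqrt 2))
        with ((sin (omega 0%Z) * sin (omega 0%Z) + cos (omega 0%Z) * cos (omega 0%Z)) * / sqrt 2) by ring.
      rewrite H; ring.
    + rewrite Xi_OS, Mapp_Mmul, IHm.
      replace (Z.of_nat m - Z.of_nat 0)%Z with (Z.of_nat (S m) - Z.of_nat 0 - 1)%Z by lia.
      rewrite Mapp_Qm_gauged by exact Ha; reflexivity.
  - induction m as [|m IHm].
    + rewrite Xi_SO, Mapp_Mmul, IHl.
      replace (Z.of_nat 0 - Z.of_nat l)%Z with (Z.of_nat 0 - Z.of_nat (S l) + 1)%Z by lia.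
      rewrite Mapp_Pm_gauged by exact Ha; unfold ampL2, ampR2.
      simpl Nat.add; rewrite !ampR_S.
      (* With no right step taken, the right-moving component must vanish. *)
      destruct (amp_outside a1 b1 (l + 0) (S l)) as [-> ->]; [lia |].
      destruct (amp_outside 0 b2 (l + 0) (S l)) as [-> ->]; [lia |].
      replace ((0 - 0) / sqrt 2) with 0 by (unfold Rdiv; ring); reflexivity.
    + rewrite Xi_SS, Mapp_Madd, !Mapp_Mmul, IHl, IHm.
      replace (Z.of_nat (S m) - Z.of_nat l)%Z with (Z.of_nat (S m) - Z.of_nat (S l) + 1)%Z by lia.
      replace (Z.of_nat m - Z.of_nat (S l))%Z with (Z.of_nat (S m) - Z.of_nat (S l) - 1)%Z by lia.
      rewrite Mapp_Pm_gauged, Mapp_Qm_gauged, Vadd_gauged by exact Ha.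
      replace (S l + m)%nat with (l + S m)%nat by lia; reflexivity.
Qed.

Definition walk_weight (omega : Z -> R) (n l : nat) : R :=
  weight (1 / sqrt 2) (sin (omega 0%Z) / sqrt 2) n l + weight 0 (cos (omega 0%Z) / sqrt 2) n l.

Lemma Cnormsq_cis_mul (t : R) (z : Cx) : Cnormsq (Cmul (cis t) z) = Cnormsq z.
Proof.
  unfold Cnormsq, Cmul, cis; simpl; generalize (sin2_cos2 t); unfold Rsqr; intros H.
  replace (_ + _) with ((sin t * sin t + cos t * cos t) * (re z * re z + im z * im z)) by ring.
  rewrite H; ring.
Qed.

Lemma prob_lm_weight (omega : Z -> R) (l m : nat) :
  prob_lm omega l m = walk_weight omega (l + m) l.
Proof.
  destruct (gauge_exists omega) as (alpha & H0 & H).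
  unfold prob_lm; rewrite (Xi_gauged omega alpha) by assumption.
  unfold Vnormsq, gauged; simpl v1; simpl v2; rewrite !Cnormsq_cis_mul.
  unfold Cnormsq, walk_weight, weight, ampL2, ampR2; simpl; ring.
Qed.

Lemma walk_weight_ge0 (omega : Z -> R) (n l : nat) : 0 <= walk_weight omega n l.
Proof.
  unfold walk_weight, weight; repeat apply Rplus_le_le_0_compat; apply pow2_ge_0.
Qed.

Lemma div_sqrt2_sqr (x : R) : (x / sqrt 2) ^ 2 = x ^ 2 / 2.
Proof.
  unfold Rdiv; rewrite Rpow_mult_distr, pow_inv, pow2_sqrt by lra; reflexivity.
Qed.

Lemma walk_weight_total (omega : Z -> R) (n : nat) : sum_f_R0 (walk_weight omega n) n = 1.
Proof.
  unfold walk_weight; rewrite sum_plus, !weight_total, !div_sqrt2_sqr.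
  generalize (sin2_cos2 (omega 0%Z)); unfold Rsqr; lra.
Qed.

(** [limit_mean] is additive in the pair (N, q). Over the real and imaginary walks the squared norms
    add up to 1, and the skews to [sin (omega 0)], since the squares of sine and cosine cancel
    against the 1/2. *)
Lemma walk_weight_testable (omega : Z -> R) :
  testable (walk_weight omega) (sin (omega 0%Z)) (fun _ => 1).
Proof.
  set (w := omega 0%Z); split; [intros; apply continuous_const |]; intros xi tau.
  assert (Hs : 2 * (1 / sqrt 2) * (sin w / sqrt 2) = sin w).
  { generalize sqrt2_gt0 sqrt2_sqr; intros H1 H2; field_simplify_eq; [| lra].
    replace (sqrt 2 ^ 2) with 2 by (simpl; lra); ring. }
  assert (Hc : cos w ^ 2 = 1 - sin w ^ 2) by apply cos_sqr.
  assert (E : forall f : R -> R, (forall x, continuous f x) ->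
    limit_mean 1 (sin w) f =
    limit_mean ((1 / sqrt 2) ^ 2 + (sin w / sqrt 2) ^ 2) (skew (1 / sqrt 2) (sin w / sqrt 2)) f
    + limit_mean (0 ^ 2 + (cos w / sqrt 2) ^ 2) (skew 0 (cos w / sqrt 2)) f).
  { intros f Hf; unfold limit_mean; rewrite <- Rmult_plus_distr_l; f_equal; symmetry.
    rewrite <- (RInt_plus (V := R_CompleteNormedModule)) by now apply ex_RInt_vel.
    apply RInt_ext; intros k _; unfold skew.
    match goal with |- plus ?x ?y = ?z => change (x + y = z :> R) end.
    rewrite Hs, !div_sqrt2_sqr, Hc; field; generalize sqrt2_gt0; lra. }
  rewrite (limit_mean_ext _ _ _ (fun x => cos (xi * x - tau))) by (intros; apply Rmult_1_l).
  rewrite E by apply continuous_cos_affine.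
  eapply is_lim_seq_ext; [| apply is_lim_seq_plus'; apply mean_cos_lim].
  intros n; unfold mean, walk_weight; rewrite <- sum_plus; apply sum_eq; intros; fold w; ring.
Qed.

(** * The limit density *)

Lemma inv_sqrt2_sqr : 0 < 1 / sqrt 2 /\ (1 / sqrt 2) * (1 / sqrt 2) = / 2.
Proof.
  generalize sqrt2_gt0 sqrt2_sqr; intros H1 H2; split.
  - apply Rdiv_lt_0_compat; lra.
  - replace (1 / sqrt 2 * (1 / sqrt 2)) with (/ (sqrt 2 * sqrt 2)) by (field; lra); now rewrite H2.
Qed.

Lemma radicand_gt0 (x : R) : - (1 / sqrt 2) < x < 1 / sqrt 2 -> 0 < 1 - 2 * x ^ 2.
Proof. intros Hx; destruct inv_sqrt2_sqr as [H1 H2]; nra. Qed.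

Lemma vel_PI2 : vel (PI / 2) = 1 / sqrt 2.
Proof. unfold vel; rewrite sin_PI2; do 2 f_equal; ring. Qed.

(** Inverse of [vel] on the open half period: [x = vel k] gives [sin k = x / sqrt (1 - x ^ 2)],
    hence this tangent. *)
Definition wavenumber (x : R) : R := atan (x / sqrt (1 - 2 * x ^ 2)).

Lemma vel_wavenumber (x : R) : - (1 / sqrt 2) < x < 1 / sqrt 2 -> vel (wavenumber x) = x.
Proof.
  intros Hx; generalize (radicand_gt0 x Hx); intros Hr.
  assert (Hr' : 0 < 1 - x ^ 2) by (generalize (pow2_ge_0 x); lra).
  unfold wavenumber; set (w := sqrt (1 - 2 * x ^ 2)).
  assert (Hw : 0 < w /\ w ^ 2 = 1 - 2 * x ^ 2).
  { split; [now apply sqrt_lt_R0 | apply pow2_sqrt; lra]. }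
  set (y := sqrt (1 - x ^ 2)).
  assert (Hy : 0 < y /\ y ^ 2 = 1 - x ^ 2).
  { split; [now apply sqrt_lt_R0 | apply pow2_sqrt; lra]. }
  assert (Hs : sin (atan (x / w)) = x / y).
  { rewrite sin_atan.
    replace (1 + (x / w)²) with ((1 - x ^ 2) / w ^ 2).
    - rewrite sqrt_div by (try (apply pow_lt); lra).
      rewrite sqrt_pow2 by lra; fold y; field; lra.
    - unfold Rsqr; rewrite (proj2 Hw); replace (x / w * (x / w)) with (x ^ 2 / w ^ 2) by (field; lra).
      rewrite (proj2 Hw); field; lra. }
  unfold vel; rewrite Hs.
  replace (1 + (x / y) ^ 2) with (1 / y ^ 2).
  - rewrite sqrt_div by (try (apply pow_lt); lra).
    rewrite sqrt_pow2, sqrt_1 by lra; field; lra.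
  - replace ((x / y) ^ 2) with (x ^ 2 / y ^ 2) by (field; lra).
    rewrite (proj2 Hy); field; lra.
Qed.

Lemma wavenumber_bounds (x : R) : - (PI / 2) < wavenumber x < PI / 2.
Proof. generalize (atan_bound (x / sqrt (1 - 2 * x ^ 2))); unfold wavenumber; lra. Qed.

Lemma vel_lt_inv (x y : R) :
  - (PI / 2) <= y -> x <= PI / 2 -> vel x < vel y -> x < y.
Proof.
  intros Hy Hx H; destruct (Rlt_le_dec x y) as [|[H'|H']]; [assumption | | subst; lra].
  generalize (vel_lt y x Hy H' Hx); lra.
Qed.

(** For t outside the support an end of the half period serves as k0, and one of the two conditions
    becomes vacuous. *)
Lemma threshold_exists (t : R) :
  exists k0, - (PI / 2) <= k0 <= PI / 2 /\
    vel k0 = Rmax (- (1 / sqrt 2)) (Rmin t (1 / sqrt 2)) /\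
    (forall k, - (PI / 2) <= k < k0 -> vel k < t) /\
    (forall k, k0 < k <= PI / 2 -> t < vel k).
Proof.
  generalize PI_gt2 vel_PI2 (vel_opp (PI / 2)) inv_sqrt2_sqr; intros HPI V1 V2 [Hs _].
  rewrite V1 in V2.
  destruct (Rle_lt_dec t (- (1 / sqrt 2))) as [H | H];
    [| destruct (Rle_lt_dec (1 / sqrt 2) t) as [H' | H']].
  - exists (- (PI / 2)); split; [lra | split; [| split]]; try (intros k Hk; exfalso; lra).
    + rewrite V2, Rmin_left, Rmax_left; lra.
    + intros k Hk; generalize (vel_lt (- (PI / 2)) k); lra.
  - exists (PI / 2); split; [lra | split; [| split]]; try (intros k Hk; exfalso; lra).
    + rewrite V1, Rmin_right, Rmax_right; lra.
    + intros k Hk; generalize (vel_lt k (PI / 2)); lra.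
  - generalize (wavenumber_bounds t) (vel_wavenumber t (conj H H')); intros B V.
    exists (wavenumber t); split; [lra | split; [| split]]; try (intros k Hk; exfalso; lra).
    + rewrite V, Rmin_left, Rmax_right; lra.
    + intros k Hk; generalize (vel_lt k (wavenumber t)); lra.
    + intros k Hk; generalize (vel_lt (wavenumber t) k); lra.
Qed.

(** On the support this derivative is [PI * fK x]: the density is the Jacobian of the
    substitution. *)
Lemma is_derive_wavenumber (x : R) : - (1 / sqrt 2) < x < 1 / sqrt 2 ->
  is_derive wavenumber x (1 / ((1 - x ^ 2) * sqrt (1 - 2 * x ^ 2))).
Proof.
  intros Hx; generalize (radicand_gt0 x Hx); intros Hr.
  assert (Hr' : 0 < 1 - x ^ 2) by (generalize (pow2_ge_0 x); lra).
  assert (Hw : 0 < sqrt (1 - 2 * x ^ 2) /\ sqrt (1 - 2 * x ^ 2) ^ 2 = 1 - 2 * x ^ 2).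
  { split; [now apply sqrt_lt_R0 | apply pow2_sqrt; lra]. }
  unfold wavenumber; auto_derive.
  - split; [| split; [exact (Rgt_not_eq _ _ (proj1 Hw)) | exact I]].
    unfold pow in Hr; lra.
  - replace (1 + - (2 * (x * (x * 1)))) with (1 - 2 * x ^ 2) by ring.
    set (w := sqrt (1 - 2 * x ^ 2)) in *.
    replace (1 + x * / w * (x * / w * 1)) with ((1 - x ^ 2) / w ^ 2).
    + field_simplify_eq; [| repeat split; lra].
      rewrite (proj2 Hw); ring.
    + replace (x * / w * (x * / w * 1)) with (x ^ 2 / w ^ 2) by (field; lra).
      rewrite (proj2 Hw); field; lra.
Qed.

Lemma is_RInt_fK (q c d : R) : - (1 / sqrt 2) < c -> c <= d -> d < 1 / sqrt 2 ->
  is_RInt (fun x => (1 - q * x) * fK x) c d (cdf q (wavenumber d) - cdf q (wavenumber c)).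
Proof.
  intros Hc Hcd Hd; generalize PI_RGT_0; intros HPI.
  apply (is_RInt_ext (fun x => (1 - q * x) / PI * (1 / ((1 - x ^ 2) * sqrt (1 - 2 * x ^ 2))))).
  { rewrite Rmin_left, Rmax_right by exact Hcd; intros x Hx.
    generalize (radicand_gt0 x ltac:(lra)); intros Hr.
    assert (0 < 1 - x ^ 2) by (generalize (pow2_ge_0 x); lra).
    assert (0 < sqrt (1 - 2 * x ^ 2)) by now apply sqrt_lt_R0.
    unfold fK; destruct (Rlt_dec _ _); [| lra]; destruct (Rlt_dec _ _); [| lra].
    match goal with |- ?a = ?b => change (a = b :> R) end.
    field; repeat split; lra. }
  apply (is_RInt_derive (V := R_CompleteNormedModule) (fun x => cdf q (wavenumber x)));
    rewrite Rmin_left, Rmax_right by exact Hcd; intros x Hx.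
  - evar_last.
    { apply (is_derive_comp (cdf q) wavenumber); [apply is_derive_cdf | apply is_derive_wavenumber; lra]. }
    rewrite vel_wavenumber by lra; unfold scal; simpl; unfold mult; simpl; ring.
  - generalize (radicand_gt0 x ltac:(lra)); intros Hr.
    assert (0 < 1 - x ^ 2) by (generalize (pow2_ge_0 x); lra).
    assert (0 < sqrt (1 - 2 * x ^ 2)) by now apply sqrt_lt_R0.
    apply (ex_derive_continuous (V := R_NormedModule)); auto_derive.
    split; [unfold pow in Hr; lra | split; [| exact I]].
    apply Rmult_integral_contrapositive; split.
    + unfold pow in *; lra.
    + apply Rgt_not_eq; replace (1 + - (2 * (x * (x * 1)))) with (1 - 2 * x ^ 2) by ring; assumption.
Qed.

(** [fK] blows up at the ends of its support, so the truncation error is measured in the wave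
    number, where [cdf] is 1-Lipschitz up to the ends. *)
Lemma improper_integral_fK (q ka kb : R) :
  -1 <= q <= 1 -> - (PI / 2) <= ka < kb -> kb <= PI / 2 ->
  improper_integral (fun x => (1 - q * x) * fK x) (vel ka) (vel kb) (cdf q kb - cdf q ka).
Proof.
  intros Hq Ha Hb; generalize PI_gt2 vel_PI2 (vel_opp (PI / 2)); intros HPI V1 V2; rewrite V1 in V2.
  assert (Va : - (1 / sqrt 2) <= vel ka).
  { rewrite <- V2; destruct (proj1 Ha) as [H|H]; [left; apply vel_lt; lra | rewrite H; lra]. }
  assert (Vb : vel kb <= 1 / sqrt 2).
  { rewrite <- V1; destruct Hb as [H|H]; [left; apply vel_lt; lra | rewrite H; lra]. }
  split.
  - intros c d Hc Hcd Hd; constructor; apply ex_RInt_Reals_0.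
    eexists; apply is_RInt_fK; lra.
  (* Each end loses at most eta, in total less than eps; [eta <= kb - ka] keeps [ka + eta] and
     [kb - eta] inside the interval. *)
  - intros eps He; set (eta := Rmin (eps / 3) (kb - ka)).
    assert (Heta : 0 < eta /\ eta <= eps / 3 /\ eta <= kb - ka).
    { split; [apply Rmin_pos; lra | split; [apply Rmin_l | apply Rmin_r]]. }
    generalize (vel_lt ka (ka + eta)) (vel_lt (kb - eta) kb); intros D1 D2.
    exists (Rmin (vel (ka + eta) - vel ka) (vel kb - vel (kb - eta))).
    split; [apply Rmin_pos; lra |].
    intros c d pr Hc1 Hc2 Hd1 Hd2 Hcd.
    generalize (Rmin_l (vel (ka + eta) - vel ka) (vel kb - vel (kb - eta)))
      (Rmin_r (vel (ka + eta) - vel ka) (vel kb - vel (kb - eta))); intros M1 M2.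
    rewrite <- RInt_Reals, (is_RInt_unique _ _ _ _ (is_RInt_fK q c d ltac:(lra) Hcd ltac:(lra))).
    generalize (vel_wavenumber c ltac:(lra)) (vel_wavenumber d ltac:(lra)); intros Vc Vd.
    generalize (wavenumber_bounds c) (wavenumber_bounds d); intros Bc Bd.
    assert (Kc : ka < wavenumber c < ka + eta) by (split; apply vel_lt_inv; lra).
    assert (Kd : kb - eta < wavenumber d < kb) by (split; apply vel_lt_inv; lra).
    generalize (cdf_incr q ka (wavenumber c) Hq ltac:(lra)) (cdf_incr q (wavenumber d) kb Hq ltac:(lra)).
    intros I1 I2; apply Rabs_lt_between; lra.
Qed.

(** A closed half-line at v minus an open one at u, so that both endpoints are counted. *)
Lemma prob_interval_mean (omega : Z -> R) (n : nat) (u v : R) : u <= v ->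
  prob_interval omega n u v =
  mean (walk_weight omega) n (fun x => if Rle_dec x v then 1 else 0)
  - mean (walk_weight omega) n (fun x => if Rlt_dec x u then 1 else 0).
Proof.
  intros Huv; unfold prob_interval, mean; rewrite <- minus_sum; apply sum_eq; intros l Hl; cbv zeta.
  rewrite prob_lm_weight; replace (l + (n - l))%nat with n by lia.
  replace (INR (n - l) - INR l) with (site n l) by (unfold site; rewrite minus_INR by exact Hl; ring).
  set (y := site n l / INR n).
  destruct (Rle_dec u y), (Rle_dec y v), (Rlt_dec y u); try lra; ring.
Qed.

Theorem theorem2 (omega : Z -> R) (u v : R) (huv : u <= v) :
  exists I : R,
    integral_on_support (fun x => (1 - sin (omega 0%Z) * x) * fK x) u v I /\
    Un_cv (fun n => prob_interval omega n u v) I.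
Proof.
  set (q := sin (omega 0%Z)).
  assert (Hq : -1 <= q <= 1) by (unfold q; generalize (SIN_bound (omega 0%Z)); lra).
  destruct (threshold_exists u) as (ku & Bu & Vu & Lu & Gu).
  destruct (threshold_exists v) as (kv & Bv & Vv & Lv & Gv).
  exists (cdf q kv - cdf q ku); split.
  - destruct inv_sqrt2_sqr as [Hs _].
    unfold integral_on_support; cbv zeta.
    set (s := 1 / sqrt 2) in *.
    destruct (Rle_lt_dec (Rmin v s) (Rmax u (- s))) as [H | H]; [left | right]; (split; [exact H |]).
    (* When [u, v] misses the open support, both thresholds clamp to the same velocity, and strict
       monotonicity of [vel] identifies the wave numbers. *)
    + replace kv with ku; [ring |].
      assert (E : vel ku = vel kv).
      { rewrite Vu, Vv; revert H; unfold Rmin, Rmax; repeat destruct (Rle_dec _ _); lra. }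
      destruct (Rtotal_order ku kv) as [H' | [H' | H']]; [| exact H' |].
      * generalize (vel_lt ku kv); lra.
      * generalize (vel_lt kv ku); lra.
    + replace (Rmax u (- s)) with (vel ku).
      2: { rewrite Vu; revert H; unfold Rmin, Rmax; repeat destruct (Rle_dec _ _); lra. }
      replace (Rmin v s) with (vel kv).
      2: { rewrite Vv; revert H; unfold Rmin, Rmax; repeat destruct (Rle_dec _ _); lra. }
      apply improper_integral_fK; try lra; split; [lra |].
      apply vel_lt_inv; try lra.
      rewrite Vu, Vv; revert H; unfold Rmin, Rmax; repeat destruct (Rle_dec _ _); lra.
  - apply is_lim_seq_Reals.
    apply (is_lim_seq_ext (fun n => mean (walk_weight omega) n (fun x => if Rle_dec x v then 1 else 0)
      - mean (walk_weight omega) n (fun x => if Rlt_dec x u then 1 else 0))).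
    { intros n; symmetry; now apply prob_interval_mean. }
    replace (cdf q kv - cdf q ku)
      with ((cdf q kv - cdf q (- (PI / 2))) - (cdf q ku - cdf q (- (PI / 2)))) by ring.
    apply is_lim_seq_minus'.
    + apply (mean_threshold_lim _ q v kv); auto using walk_weight_ge0, walk_weight_total.
      * apply walk_weight_testable.
      * intros x; destruct (Rle_dec x v); lra.
      * intros x Hx; destruct (Rle_dec x v); lra.
      * intros x Hx; destruct (Rle_dec x v); lra.
    + apply (mean_threshold_lim _ q u ku); auto using walk_weight_ge0, walk_weight_total.
      * apply walk_weight_testable.
      * intros x; destruct (Rlt_dec x u); lra.
      * intros x Hx; destruct (Rlt_dec x u); lra.
      * intros x Hx; destruct (Rlt_dec x u); lra.
Qed.
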